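(* Let $a,b,s\ge 1$ and $n\ge 3$ be integers such that $n$ is odd, $b$ divides $a$, and $b<a$. Let $q=p^a$ be a power of a prime $p$, let $c\in\mathbb{F}_{q^2}$ satisfy $c^{q-1}=-1$, and suppose that $s$ divides $(q^n+1)/(q+1)$. Put $\tilde M=(q^n+1)/s$. Let $\mathcal{C}$ be one of the following two curves over $\mathbb{F}_{q^{2n}}$: $$\mathcal{X}_{a,b,n,s}:\ c\,y^{\tilde M}=t(x)\left(t(x)^{q-1}+1\right)^{q+1},\quad t(x)=\sum_{i=0}^{a/b-1}x^{p^{ib}},$$ $$\mathcal{Y}_{n,s}:\ y^{\tilde M}=(x^q+x)\left((x^q+x)^{q-1}-1\right)^{q+1},$$ and let $d=p^b$ if $\mathcal{C}=\mathcal{X}_{a,b,n,s}$ and $d=1$ if $\mathcal{C}=\mathcal{Y}_{n,s}$. Let $N$ be an integer with $2\le N\le q/d$, let $Q_1,\dots,Q_N$ be pairwise distinct places of $\mathbb{F}_{q^{2n}}(\mathcal{C})$ corresponding to roots of $t(x)$ if $\mathcal{C}=\mathcal{X}_{a,b,n,s}$, or to roots of $x^q+x$ if $\mathcal{C}=\mathcal{Y}_{n,s}$, and let $\mathbf{Q}=(Q_1,\dots,Q_N)$. Let $\Upsilon$ denote either $\Gamma$ or $\Lambda$, and let $\rho=0$ if $\Upsilon=\Gamma$ and $\rho=N-2$ if $\Upsilon=\Lambda$. For $1\le i\le\tilde M-1$ put $$\beta(i)=\frac{q}{d}+\frac{q(q-1)}{d}\left\lceil\frac{i(q+1)}{\tilde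 M}\right\rceil-\left\lfloor\frac{iq^3}{d\tilde M}\right\rfloor-1 .$$ Then $$\widehat{\Upsilon}(\mathbf{Q})=\left\{(\tilde Mj_1+i,\dots,\tilde Mj_N+i): 1\le i\le\tilde M-1,\ j_1,\dots,j_N\in\mathbb{Z},\ j_1+\cdots+j_N=\beta(i)+1-N+\rho\right\}$$ $$\cup\ \left\{(\tilde Mj_1,\dots,\tilde Mj_N): j_1,\dots,j_N\in\mathbb{Z},\ j_1+\cdots+j_N=\rho\right\}.$$ In particular, $$\Upsilon(\mathbf{Q})=\left\{(\tilde Mj_1+i,\dots,\tilde Mj_N+i): 1\le i\le\tilde M-1,\ j_1,\dots,j_N\in\mathbb{N}_0,\ j_1+\cdots+j_N=\beta(i)+1-N+\rho\right\}.$$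
   Context: $\mathbb{N}$ is the set of positive integers and $\mathbb{N}_0=\mathbb{N}\cup\{0\}$. $\nu_P$ is the discrete valuation at a place $P$. The place of $\mathbb{F}_{q^{2n}}(\mathcal{C})$ corresponding to a root $\gamma$ of $t(x)$ (resp. $x^q+x$) is the unique place lying over the zero of $x-\gamma$ in $\mathbb{F}_{q^{2n}}(x)$ (which is totally ramified in $\mathbb{F}_{q^{2n}}(\mathcal{C})/\mathbb{F}_{q^{2n}}(x)$). Let $F$ be a function field over a finite field and $\mathbf{Q}=(Q_1,\dots,Q_N)$ an $N$-tuple of distinct rational places. Let $R_{\mathbf{Q}}$ be the ring of functions in $F$ regular outside $\{Q_1,\dots,Q_N\}$. The generalized Weierstrass semigroup is $$\widehat{H}(\mathbf{Q})=\{(-\nu_{Q_1}(z),\dots,-\nu_{Q_N}(z))\in\mathbb{Z}^N : z\in R_{\mathbf{Q}}\setminus\{0\}\}.$$ Let $I=\{1,\dots,N\}$. For a nonempty $J\subsetneq I$ and $\alpha\in\mathbb{Z}^N$ let $$\nabla_J(\alpha)=\{\beta\in\widehat{H}(\mathbf{Q}) : \beta_j=\alpha_j \text{ for } j\in J,\ \beta_i<\alpha_i \text{ for } i\notin J\},\qquad \nabla(\alpha)=\bigcup_{i=1}^N\nabla_{\{i\}}(\alpha).$$ An element $\alpha\in\widehat{H}(\mathbf{Q})$ is maximal if $\nabla(\alpha)=\emptyset$. It is absolute maximal if it is maximal and $\nabla_J(\alpha)=\emptyset$ for every $J\subsetneq I$ with $|J|\ge 2$; it is relative maximal if it is maximal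 and $\nabla_J(\alpha)\ne\emptyset$ for every $J\subsetneq I$ with $|J|\ge2$. $\widehat{\Gamma}(\mathbf{Q})$ and $\widehat{\Lambda}(\mathbf{Q})$ denote the sets of absolute maximal and relative maximal elements of $\widehat{H}(\mathbf{Q})$, respectively, and $$\Gamma(\mathbf{Q})=\widehat{\Gamma}(\mathbf{Q})\cap\mathbb{N}^N,\qquad \Lambda(\mathbf{Q})=\widehat{\Lambda}(\mathbf{Q})\cap\mathbb{N}^N.$$ *)

(* Defs.v *)
From HB Require Import structures.
From mathcomp Require Import all_boot all_order all_algebra.
From mathcomp Require Import boolp classical_sets.

Set Implicit Arguments.
Unset Strict Implicit.
Unset Printing Implicit Defensive.

Import Order.TTheory GRing.Theory Num.Theory.

Local Open Scope ring_scope.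
Local Open Scope classical_set_scope.

(* A field extension F / K is given by its structure map iota : K -> F. *)

Section Places.
Variables (K F : fieldType) (iota : {rmorphism K -> F}).

(* A place P of F / K is encoded by its valuation ring O_P; the place as a set
   is the maximal ideal place_ideal P. *)
Record place := Place {
  place_ring : set F;
  place_const : forall k : K, place_ring (iota k);
  place_add : forall z w, place_ring z -> place_ring w -> place_ring (z + w);
  place_mul : forall z w, place_ring z -> place_ring w -> place_ring (z * w);
  place_proper : place_ring <> setT;
  place_total : forall z, place_ring z \/ place_ring z^-1
}.

Definition place_unit (P : place) : set F :=
  [set z | [/\ z != 0, place_ring P z & place_ring P z^-1]].

Definition place_ideal (P : place) : set F :=
  place_ring P `\` place_unit P.

Definition prime_element (P : place) (t : F) : Prop :=
  place_ideal P = [set t * w | w in place_ring P].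

(* The k such that z = t ^ k * u with t a prime element and u a unit of O_P.
   Only meaningful for z != 0: nu P 0 is a junk value, not +oo. *)
Definition nu (P : place) (z : F) : int :=
  xget 0 [set k : int | exists t u,
    [/\ prime_element P t, place_unit P u & z = t ^ k * u]].

(* The zero of x - gamma in K(x) is the set of all f(x) / g(x) with f(gamma) = 0
   and g(gamma) <> 0; P lies over it when P contains it. *)
Definition lies_over_zero (x : F) (gamma : K) (P : place) : Prop :=
  forall f g : {poly K}, root f gamma -> ~~ root g gamma ->
    place_ideal P ((map_poly iota f).[x] / (map_poly iota g).[x]).

End Places.

Section Semigroup.
Variables (K F : fieldType) (iota : {rmorphism K -> F}).
Variables (N : nat) (Q : 'I_N -> place iota).

Definition regular_outside : set F :=
  [set z | forall P : place iota, ~ range Q P -> place_ring P z].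

Definition weierstrass_semigroup : set ('I_N -> int) :=
  [set alpha | exists z, [/\ regular_outside z, z != 0 &
     alpha = (fun i => - nu (Q i) z)]].

Definition nabla_on (J : {set 'I_N}) (alpha : 'I_N -> int) :
    set ('I_N -> int) :=
  [set beta | [/\ weierstrass_semigroup beta,
     forall j, j \in J -> beta j = alpha j &
     forall i, i \notin J -> beta i < alpha i]].

Definition nabla (alpha : 'I_N -> int) : set ('I_N -> int) :=
  \bigcup_(i in [set: 'I_N]) nabla_on [set i]%SET alpha.

Definition maximal : set ('I_N -> int) :=
  [set alpha | weierstrass_semigroup alpha /\ nabla alpha = set0].

Definition absolute_maximal : set ('I_N -> int) :=
  [set alpha | maximal alpha /\
     forall J : {set 'I_N}, J \proper [set: 'I_N]%SET -> (2 <= #|J|)%N ->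
       nabla_on J alpha = set0].

Definition relative_maximal : set ('I_N -> int) :=
  [set alpha | maximal alpha /\
     forall J : {set 'I_N}, J \proper [set: 'I_N]%SET -> (2 <= #|J|)%N ->
       nabla_on J alpha !=set0].

End Semigroup.

Variant upsilon := UGamma | ULambda.

Definition upsilon_hat (U : upsilon) (K F : fieldType)
    (iota : {rmorphism K -> F}) (N : nat) (Q : 'I_N -> place iota) :
    set ('I_N -> int) :=
  match U with
  | UGamma => absolute_maximal Q
  | ULambda => relative_maximal Q
  end.

Definition upsilon_pos (U : upsilon) (K F : fieldType)
    (iota : {rmorphism K -> F}) (N : nat) (Q : 'I_N -> place iota) :
    set ('I_N -> int) :=
  upsilon_hat U Q `&` [set alpha | forall i, 0 < alpha i].

Definition rho (U : upsilon) (N : nat) : int :=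
  match U with
  | UGamma => 0
  | ULambda => N%:Z - 2
  end.

(* Elements of K[x][y]: the outer variable of {poly {poly K}} is y and the inner
   one is x. *)
Definition eval_xy (K F : fieldType) (iota : {rmorphism K -> F}) (x y : F)
    (g : {poly {poly K}}) : F :=
  (map_poly (map_poly iota) g).[y%:P].[x].

(* F is the fraction field of the coordinate ring K[x, y] / (f). *)
Definition is_function_field (K F : fieldType) (iota : {rmorphism K -> F})
    (x y : F) (f : {poly {poly K}}) : Prop :=
  (forall g, eval_xy iota x y g = 0 <-> exists h, g = f * h) /\
  (forall z, exists g h, eval_xy iota x y h != 0 /\
     z = eval_xy iota x y g / eval_xy iota x y h).

Variant curve := CurveX | CurveY.

Section Curves.
Variable K : fieldType.

(* t(x) for CurveX and x^q + x for CurveY, with q = p ^ a. *)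
Definition base_poly (C : curve) (p a b : nat) : {poly K} :=
  match C with
  | CurveX => \sum_(i < a %/ b) 'X^(p ^ (i * b))
  | CurveY => 'X^(p ^ a) + 'X
  end.

Definition curve_poly (C : curve) (p a b M : nat) (c : K) : {poly {poly K}} :=
  let q := (p ^ a)%N in
  let t := base_poly C p a b in
  match C with
  | CurveX => c%:P *: 'X^M - (t * (t ^+ (q - 1) + 1) ^+ (q + 1))%:P
  | CurveY => 'X^M - (t * (t ^+ (q - 1) - 1) ^+ (q + 1))%:P
  end.

End Curves.

Definition curve_d (C : curve) (p b : nat) : nat :=
  match C with
  | CurveX => (p ^ b)%N
  | CurveY => 1
  end.

(* Both nat divisions are exact when d divides q. *)
Definition beta (q d M i : nat) : int :=
  (q %/ d)%:Z
  + (q * (q - 1) %/ d)%:Z * Num.ceil ((i * (q + 1))%:R / M%:R : rat)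
  - Num.floor ((i * q ^ 3)%:R / (d * M)%:R : rat) - 1.

(* Main.v *)
(** Idea. Divided by its leading constant the curve becomes [y ^ M = h(x)], with
    [h = u t E ^ (q + 1)], [t] and [E] separable and coprime and [q + 1] dividing
    [M]. At a place over a root of [t], [y] is a uniformizer and
    [K(x)] has values in [M Z]. The ground field contains the [M]-th roots of unity;
    averaging over the resulting Kummer automorphisms, which permute the places
    outside [Q], splits a function regular outside [Q] into regular components
    [r_i(x) y^-i], [0 <= i < M], whose values at each [Q_k] are pairwise distinct.
    So the generalized semigroup consists of pointwise maxima of tuples
    [(M j_k + i)_k], and such a tuple belongs to it as soon as
    [sum_k j_k >= B_i]. The bound [B_i] comes out of divisibility in [K[x]] (at the
    finite places) and of the degree (at infinity), applied to the [M]-th power of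
    the component, which lies in [K(x)]; the places needed to detect a pole are
    supplied by Zorn's lemma. Absolute and relative
    maximality then read [sum_k j_k = B_i] and [sum_k j_k = B_i + N - 2]. *)

Require Import Defs.
From HB Require Import structures.
From mathcomp Require Import all_boot all_order all_algebra.
From mathcomp Require Import cyclic separable finfield.
From mathcomp Require Import boolp classical_sets.
From mathcomp Require Import ring zify.

Set Implicit Arguments.
Unset Strict Implicit.
Unset Printing Implicit Defensive.

Import Order.TTheory GRing.Theory Num.Theory.

Local Open Scope ring_scope.
Local Open Scope classical_set_scope.

(** * Valuation rings from Zorn's lemma *)

(** [regular_outside] quantifies over all places, so each lower bound needs a place that witnesses a
    pole, possibly above an irreducible polynomial without roots in [K]. A maximal subring avoiding
    a given element yields such a place without any description of the places of [F]. At the places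
    above [E] and at infinity the value of [y] is not tracked. Passing to [M]-th powers lands in
    [K(x)] and loses nothing, because valuation rings are integrally closed. The ceiling comes from
    [M = (q + 1) m]: if [E ^ ((q + 1) i)] divides [A ^ M], then [E ^ i] divides [A ^ m], hence
    [E ^ ceil(i / m)] divides [A]. The floor comes from [deg h = (q / d) q ^ 2] at infinity. For [J]
    proper and nonempty, [nabla_on J] is nonempty at [(M j_k + i)_k] exactly when
    [sum_k j_k >= B_i + N - |J|]. So absolute maximality is decided by [|J| = N - 1], and relative
    maximality by [|J| = 1] and [|J| = 2] (membership itself when [N = 2]), whence the shift
    [N - 2]. *)

Section ValuationRings.
Variable F : fieldType.
Implicit Types (A V : set F) (p : {poly F}).

Definition is_subring A : Prop :=
  [/\ A 1, forall z w, A z -> A w -> A (z - w) &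
      forall z w, A z -> A w -> A (z * w)].

Section SubringTheory.
Variables (V : set F) (hV : is_subring V).

Lemma subring1 : V 1. Proof. by case: hV. Qed.
Lemma subringB z w : V z -> V w -> V (z - w).
Proof. by case: hV => _ h _; apply: h. Qed.
Lemma subringM z w : V z -> V w -> V (z * w).
Proof. by case: hV => _ _; apply. Qed.
Lemma subring0 : V 0.
Proof. by rewrite -(subrr 1); apply: subringB subring1 subring1. Qed.
Lemma subringN z : V z -> V (- z).
Proof. by rewrite -sub0r; apply: subringB subring0. Qed.
Lemma subringD z w : V z -> V w -> V (z + w).
Proof. by move=> Vz /subringN Vw; rewrite -[w]opprK; apply: subringB. Qed.
Lemma subringX z n : V z -> V (z ^+ n).
Proof.
by move=> Vz; elim: n => [|n IH]; rewrite ?expr0 ?exprS; [apply: subring1|apply: subringM].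
Qed.
Lemma subring_sum (I : Type) (r : seq I) (P : pred I) (f : I -> F) :
  (forall i, P i -> V (f i)) -> V (\sum_(i <- r | P i) f i).
Proof. by move=> h; elim/big_ind: _ => //; [apply: subring0|apply: subringD]. Qed.
Lemma subring_prod (I : Type) (r : seq I) (P : pred I) (f : I -> F) :
  (forall i, P i -> V (f i)) -> V (\prod_(i <- r | P i) f i).
Proof. by move=> h; elim/big_ind: _ => //; [apply: subring1|apply: subringM]. Qed.

Definition adjoin (u : F) : set F :=
  [set z | exists2 p : {poly F}, forall i, V p`_i & z = p.[u]].

Lemma adjoin_subring u : is_subring (adjoin u).
Proof.
split.
- exists 1; last by rewrite hornerC.
  by move=> i; rewrite coef1; case: (i == 0)%N; [apply: subring1|apply: subring0].
- move=> z w [p hp ->] [r hr ->]; exists (p - r); last by rewrite hornerD hornerN.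
  by move=> i; rewrite coefB; apply: subringB.
- move=> z w [p hp ->] [r hr ->]; exists (p * r); last by rewrite hornerM.
  by move=> i; rewrite coefM; apply: subring_sum => j _; apply: subringM.
Qed.

Lemma sub_adjoin u : V `<=` adjoin u.
Proof.
move=> z Vz; exists z%:P; last by rewrite hornerC.
by move=> i; rewrite coefC; case: (i == 0)%N => //; apply: subring0.
Qed.

Lemma adjoin_gen u : adjoin u u.
Proof.
exists 'X; last by rewrite hornerX.
by move=> i; rewrite coefX; case: (i == 1)%N; [apply: subring1|apply: subring0].
Qed.

End SubringTheory.

Lemma maximal_subring_avoiding A z : is_subring A -> ~ A z ->
  exists V, [/\ is_subring V, A `<=` V, ~ V z &
    forall W, is_subring W -> V `<=` W -> ~ W z -> W `<=` V].
Proof.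
move=> hA nAz.
pose P B := B = set0 \/ [/\ is_subring B, A `<=` B & ~ B z].
have [|V [PV maxV]] := @Zorn_bigcup F P.
  move=> G GP tot.
  have [[B [GB nB0]]|none] := pselect (exists B, G B /\ B <> set0); last first.
    left; rewrite -subset0 => u [B GB Bu]; apply: none; exists B; split=> //.
    by move=> B0; rewrite B0 in Bu.
  have sub B' u : G B' -> B' u -> [/\ is_subring B', A `<=` B' & ~ B' z].
    by move=> GB' B'u; case: (GP _ GB') => // B'0; rewrite B'0 in B'u.
  have [B0|[hB AB _]] := GP _ GB; first by case: nB0.
  have join2 u v : (\bigcup_(X in G) X) u -> (\bigcup_(X in G) X) v ->
      exists B', [/\ G B', B' u & B' v].
    move=> [B1 G1 u1] [B2 G2 v2]; have [h|h] := tot _ _ G1 G2.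
      by exists B2; split=> //; apply: h.
    by exists B1; split=> //; apply: h.
  right; split; [split| |].
  - by exists B => //; apply: subring1.
  - move=> u v hu hv; have [B' [GB' B'u B'v]] := join2 _ _ hu hv.
    by exists B' => //; have [hB' _ _] := sub _ _ GB' B'u; apply: subringB.
  - move=> u v hu hv; have [B' [GB' B'u B'v]] := join2 _ _ hu hv.
    by exists B' => //; have [hB' _ _] := sub _ _ GB' B'u; apply: subringM.
  - by move=> u Au; exists B => //; apply: AB.
  - by move=> [B' GB' B'z]; have [_ _] := sub _ _ GB' B'z.
have A1 := subring1 hA.
case: PV => [V0|[hV AV nVz]].
  exfalso; apply: (maxV A); last by right; split.
  by rewrite V0; split; [exact: sub0set|move=> /(_ _ A1)].
exists V; split=> // W hW VW nWz.
have [//|nWV] := pselect (W `<=` V).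
exfalso; apply: (maxV W); first by split.
by right; split=> // u /AV /VW.
Qed.

Section MaximalSubring.
Variables (V : set F) (z : F).
Hypotheses (hV : is_subring V) (nVz : ~ V z) (Vzi : V z^-1).
Hypothesis maxV : forall W, is_subring W -> V `<=` W -> ~ W z -> W `<=` V.

Let z_neq0 : z != 0.
Proof. by apply/eqP => z0; apply: nVz; rewrite z0; apply: subring0. Qed.

(** [V[u]] is strictly larger than [V], so by maximality it can no longer avoid [z]. *)
Lemma maximal_subring_adjoin u : ~ V u -> adjoin V u z.
Proof.
move=> nVu; apply/not_notP => nz; apply: nVu.
apply: (maxV (adjoin_subring hV u) (sub_adjoin hV u) nz).
exact: adjoin_gen.
Qed.

(* [1 / z] lies in the Jacobson radical of [V]. *)
Lemma maximal_subring_unit b : V b ->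
  1 - z^-1 * b != 0 /\ V (1 - z^-1 * b)^-1.
Proof.
move=> Vb; set e := 1 - z^-1 * b.
have Ve : V e by apply: subringB => //; [apply: subring1|apply: subringM].
have e0 : e != 0.
  apply/eqP => /eqP; rewrite subr_eq0 => /eqP zb; apply: nVz.
  suff -> : z = b by [].
  by rewrite -[LHS]mulr1 zb mulrA divff // mul1r.
split=> //; apply/not_notP => nVei.
have [p Vp zE] := maximal_subring_adjoin nVei.
(* Multiplying [z = p(e^-1)] by [e ^ size p] clears denominators, while [e ^ size p] is [1] modulo
   [z^-1 V]; so [z] differs from an element of [V] by an element of [V]. *)
have Vpe : V (z * e ^+ size p).
  rewrite zE horner_coef mulr_suml; apply: (subring_sum hV) => i _.
  have -> : e ^+ size p = e ^+ i * e ^+ (size p - i) by rewrite -exprD subnKC // ltnW.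
  rewrite -mulrA exprVn mulKf ?expf_neq0 //.
  by apply: subringM => //; apply: subringX.
have [b' Vb' eE] : exists2 b', V b' & e ^+ size p = 1 - z^-1 * b'.
  elim: (size p) => [|n [b' Vb' IH]].
    by exists 0; [apply: subring0|rewrite expr0; ring].
  exists (b' + b - z^-1 * b * b'); last by rewrite exprS IH /e; ring.
  apply: subringB => //; first exact: subringD.
  by do 2?apply: subringM.
apply: nVz; have -> : z = z * e ^+ size p + b' by rewrite eE; field.
exact: subringD.
Qed.

(** A relation [z = u p(u)] of degree at most [n] in [u], without constant term. This normal form
    lets a relation for [u] be shortened by one for [u^-1], as in the classical proof of Chevalley's
    extension theorem. *)
Let dep u n := exists p : {poly F}, [/\ forall i, V p`_i, (size p <= n)%N &
  1 = z^-1 * (u * p.[u])].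

Let dep_adjoin u (p : {poly F}) n : (forall i, V p`_i) -> (size p <= n)%N -> z = p.[u] ->
  dep u n.-1.
Proof.
move=> Vp sp zE; pose e := 1 - z^-1 * p`_0.
(* The constant term is moved to the left, [1 - z^-1 p_0 = z^-1 u a(u)], and the left side is
   invertible in [V]. *)
have [e0 Vei] := maximal_subring_unit (Vp 0%N).
pose r := e^-1 *: \poly_(i < n.-1) p`_i.+1.
exists r; split.
- move=> i; rewrite coefZ coef_poly; case: ifP => _; last by rewrite mulr0; apply: subring0.
  exact: subringM.
- by apply: leq_trans (size_scale_leq _ _) _; apply: size_poly.
have pE : p = 'X * (\poly_(i < n.-1) p`_i.+1) + (p`_0)%:P.
  apply/polyP => i; rewrite coefD coefXM coefC coef_poly.
  case: i => [|i] /=; first by rewrite add0r.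
  rewrite addr0; case: ifP => // /negbT; rewrite -leqNgt => ni.
  by rewrite nth_default //; apply: leq_trans sp _; case: (n) ni.
rewrite /r hornerZ; move: zE; rewrite {1}pE hornerD hornerM hornerX hornerC => zE.
set a := (\poly_(i < _) _).[u] in zE *.
have -> : z^-1 * (u * (e^-1 * a)) = e^-1 * (z^-1 * (u * a)) by ring.
have -> : u * a = z - p`_0 by rewrite zE addrK.
by rewrite mulrBr mulVf // mulVf.
Qed.

Let dep_step u n m : u != 0 -> (0 < n)%N -> (m <= n)%N ->
  dep u n -> dep u^-1 m -> dep u n.-1.
Proof.
move=> u0; case: n => // n _ mn [p [Vp sp pE]] [r [Vr sr rE]].
pose a := p`_n.
(* The top term [a u ^ (n + 1)], multiplied by [1 = z^-1 u^-1 r(u^-1)], drops to degree at most [n];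
   the bound on [m] keeps its exponents nonnegative. Thus [s] expresses [z] with one degree less. *)
pose s := 'X * \poly_(i < n) p`_i + \poly_(i < n.+1) (a * z^-1 * r`_(n - i)).
have sE : s.[u] = z.
  have key : a * u ^+ n * u = \sum_(i < n.+1) a * z^-1 * r`_(n - i) * u ^+ i.
    have -> : a * u ^+ n * u = a * u ^+ n * u * (z^-1 * (u^-1 * r.[u^-1])).
      by rewrite -rE mulr1.
    rewrite (horner_coef_wide _ (leq_trans sr mn)) (reindex_inj rev_ord_inj) /=.
    rewrite !mulr_sumr; apply: eq_bigr => i _; rewrite subSS.
    have -> : u ^+ n = u ^+ (n - i) * u ^+ i by rewrite -exprD subnK ?leq_ord.
    rewrite exprVn.
    have ux : u ^+ (n - i) != 0 by rewrite expf_neq0.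
    by field; rewrite ?u0 ?ux ?z_neq0.
  rewrite /s hornerD hornerM hornerX !horner_poly -key.
  have -> : z = z * (z^-1 * (u * p.[u])) by rewrite -pE mulr1.
  rewrite (horner_coef_wide _ sp) big_ord_recr /= -/a.
  by field; rewrite ?z_neq0.
apply: (@dep_adjoin u s) => //.
  move=> i; rewrite coefD coefXM !coef_poly; apply: subringD => //.
    by case: i => [|i] /=; [|case: ifP => _ //]; apply: subring0.
  case: ifP => _; last exact: subring0.
  exact: subringM (subringM hV (Vp n) Vzi) (Vr _).
rewrite (leq_trans (size_polyD _ _)) // geq_max size_poly andbT.
rewrite (leq_trans (size_polyMleq _ _)) // size_polyX /= addSn /= ltnS.
by rewrite size_poly.
Qed.

Lemma maximal_subring_total u : V u \/ V u^-1.
Proof.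
have [Vu|nVu] := pselect (V u); first by left.
have [Vui|nVui] := pselect (V u^-1); first by right.
exfalso.
have u0 : u != 0 by apply/eqP => u0; apply: nVu; rewrite u0; apply: subring0.
have ndep0 v : ~ dep v 0.
  move=> [p [_]]; rewrite leqn0 size_poly_eq0 => /eqP -> /eqP.
  by rewrite horner0 !mulr0 oner_eq0.
have ex v : ~ V v -> exists n, dep v n.
  by move=> /maximal_subring_adjoin [p Vp zE]; eexists; apply: (dep_adjoin Vp (leqnn _) zE).
have [n dn] := ex _ nVu; have [m dm] := ex _ nVui.
(* Descent on the total length: of a relation for [u] and one for [u^-1], the longer can always be
   shortened, yet no relation has length 0. *)
have [k] := ubnP (n + m)%N.
move: dn dm; elim: k n m => // k IH n m dn dm nmk.
have n0 : (0 < n)%N by case: n dn {nmk} => // /ndep0.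
have m0 : (0 < m)%N by case: m dm {nmk} => // /ndep0.
have [mn|/ltnW nm] := leqP m n.
  apply: (IH n.-1 m _ dm); first exact: dep_step dn dm.
  by case: n n0 nmk {dn mn}.
apply: (IH n m.-1 dn); last by case: m m0 nmk {dm nm} => // m _; rewrite addnS.
by apply: dep_step nm dm _; rewrite ?invr_eq0 ?invrK.
Qed.

End MaximalSubring.

Lemma valuation_ring_avoiding A z : is_subring A -> ~ A z -> A z^-1 ->
  exists V, [/\ is_subring V, A `<=` V, ~ V z & forall u, V u \/ V u^-1].
Proof.
move=> hA nAz Azi; have [V [hV AV nVz maxV]] := maximal_subring_avoiding hA nAz.
exists V; split=> // u; apply: (maximal_subring_total hV nVz _ maxV).
exact: AV.
Qed.

End ValuationRings.

(** * Places and valuations *)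

Section PlaceTheory.
Variables (K F : fieldType) (iota : {rmorphism K -> F}).
Implicit Types (P : place iota) (z w u t : F).

Lemma place_subring P : is_subring (place_ring P).
Proof.
have ON z : place_ring P z -> place_ring P (- z).
  move=> Oz; rewrite -mulN1r; apply: place_mul => //.
  by rewrite -(rmorphN1 iota); apply: place_const.
split; [| |exact: place_mul].
- by rewrite -(rmorph1 iota); apply: place_const.
- by move=> z w Oz Ow; apply: place_add => //; apply: ON.
Qed.

Lemma place0 P : place_ring P 0.
Proof. by apply: subring0; apply: place_subring. Qed.

Lemma place1 P : place_ring P 1.
Proof. by apply: subring1; apply: place_subring. Qed.

Lemma placeN P z : place_ring P z -> place_ring P (- z).
Proof. by apply: subringN; apply: place_subring. Qed.

Lemma placeX P z n : place_ring P z -> place_ring P (z ^+ n).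
Proof. by apply: subringX; apply: place_subring. Qed.

Lemma place_prod P (I : Type) (r : seq I) (C : pred I) (f : I -> F) :
  (forall i, C i -> place_ring P (f i)) -> place_ring P (\prod_(i <- r | C i) f i).
Proof. by apply: subring_prod; apply: place_subring. Qed.

Lemma place_eq P P' : place_ring P = place_ring P' -> P = P'.
Proof.
case: P P' => [O1 c1 a1 m1 p1 t1] [O2 c2 a2 m2 p2 t2] /= e.
rewrite e in c1 a1 m1 p1 t1 *.
by congr Place; apply: Prop_irrelevance.
Qed.

(** Integral closedness in its simplest form: if [z^-1] lies in the ring, then so does
    [z = z ^ m (z^-1) ^ (m - 1)]. *)
Lemma place_root P z m : (0 < m)%N -> place_ring P (z ^+ m) -> place_ring P z.
Proof.
case: m => // m _ Ozm; have [//|Ozi] := place_total P z.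
have [->|z0] := eqVneq z 0; first exact: place0.
have -> : z = z ^+ m.+1 * z^-1 ^+ m by rewrite exprS -mulrA -exprMn divff // expr1n mulr1.
by apply: place_mul => //; apply: placeX.
Qed.

Lemma place_idealE P z : z != 0 -> place_ideal P z <-> ~ place_ring P z^-1.
Proof.
move=> z0; split=> [[Oz nuz] Ozi|nOzi]; first exact: nuz.
split; last by case.
by case: (place_total P z) => // /nOzi.
Qed.

Lemma place_ideal0 P : place_ideal P 0.
Proof.
split; first exact: place0.
by case; rewrite eqxx.
Qed.

Lemma place_idealM P z w : place_ideal P z -> place_ring P w -> place_ideal P (z * w).
Proof.
move=> Iz Ow; have [->|z0] := eqVneq z 0; first by rewrite mul0r; apply: place_ideal0.
have [->|w0] := eqVneq w 0; first by rewrite mulr0; apply: place_ideal0.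
apply/place_idealE; first by rewrite mulf_neq0.
move=> Ozw; move/(place_idealE P z0): Iz; apply.
have -> : z^-1 = (z * w)^-1 * w by rewrite invfM mulfVK.
exact: place_mul.
Qed.

Lemma place_idealD P z w : place_ideal P z -> place_ideal P w -> place_ideal P (z + w).
Proof.
have wlog z1 w1 : w1 != 0 -> place_ring P (z1 / w1) -> place_ideal P w1 ->
    place_ideal P (z1 + w1).
  move=> w0 Oq Iw; have -> : z1 + w1 = w1 * (z1 / w1 + 1).
    by rewrite mulrDr mulr1 mulrCA divff // mulr1.
  apply: place_idealM => //; apply: place_add => //.
  exact: place1.
move=> Iz Iw; have [->|w0] := eqVneq w 0; first by rewrite addr0.
have [->|z0] := eqVneq z 0; first by rewrite add0r.
have [Oq|] := place_total P (z / w); first exact: wlog.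
by rewrite invf_div addrC => Oq; apply: wlog.
Qed.

Lemma place_unit1 P : place_unit P 1.
Proof.
have := place1 P.
by split; rewrite ?oner_neq0 ?invr1.
Qed.

Lemma place_unitM P z w : place_unit P z -> place_unit P w -> place_unit P (z * w).
Proof.
move=> [z0 Oz Ozi] [w0 Ow Owi].
by split; rewrite ?mulf_neq0 ?invfM //; apply: place_mul.
Qed.

Lemma place_unitV P z : place_unit P z -> place_unit P z^-1.
Proof. by move=> [z0 Oz Ozi]; split; rewrite ?invr_eq0 ?invrK. Qed.

Lemma place_unitX P z n : place_unit P z -> place_unit P (z ^+ n).
Proof.
move=> uz; elim: n => [|n IH]; first by rewrite expr0; apply: place_unit1.
by rewrite exprS; apply: place_unitM.
Qed.

Lemma place_unitXz P z (k : int) : place_unit P z -> place_unit P (z ^ k).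
Proof.
move=> uz; case: k => n; first exact: place_unitX.
exact: place_unitV (place_unitX n.+1 uz).
Qed.

Lemma place_unit_ideal P z : place_unit P z -> ~ place_ideal P z.
Proof. by move=> uz []. Qed.

Lemma place_unitD P z w : place_unit P z -> place_ideal P w -> place_unit P (z + w).
Proof.
move=> uz Iw; have [z0 Oz Ozi] := uz; have [Ow _] := Iw.
apply/not_notP => nu; have Izw : place_ideal P (z + w).
  by split=> //; apply: place_add.
apply: (place_unit_ideal uz); rewrite -[z](addrK w).
apply: place_idealD => //; rewrite -mulrN1; apply: place_idealM => //.
exact: placeN (place1 P).
Qed.

Lemma place_ideal_sum P (I : Type) (r : seq I) (C : pred I) (f : I -> F) :
  (forall i, C i -> place_ideal P (f i)) -> place_ideal P (\sum_(i <- r | C i) f i).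
Proof. by move=> h; elim/big_ind: _ => //; [apply: place_ideal0|apply: place_idealD]. Qed.

(** A relation to a fixed [t] rather than a function: values can be computed before [t] is known to
    be a prime element, and also relative to a [t] that need not be one, such as [x^-1] at
    infinity. *)
Definition has_val P t z (k : int) := exists2 u, place_unit P u & z = t ^ k * u.

Section Uniformizer.
Variables (P : place iota) (t : F).
Hypotheses (t0 : t != 0) (It : place_ideal P t).

Lemma has_val_ring z k : has_val P t z k -> 0 <= k -> place_ring P z.
Proof.
move=> [u [_ Ou _] ->]; case: k => // n _; apply: place_mul => //.
by apply: placeX; case: It.
Qed.

Lemma has_val_ideal z k : has_val P t z k -> 0 < k -> place_ideal P z.
Proof.
move=> [u [_ Ou _] ->]; case: k => // -[//|n] _; rewrite -exprnP exprS -mulrA.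
apply: place_idealM => //; apply: place_mul => //.
by apply: placeX; case: It.
Qed.

Lemma has_val_neq0 z k : has_val P t z k -> z != 0.
Proof. by move=> [u [u0 _ _] ->]; rewrite mulf_neq0 ?expfz_neq0. Qed.

Lemma has_valV z k : has_val P t z k -> has_val P t z^-1 (- k).
Proof.
move=> [u uu ->]; exists u^-1; first exact: place_unitV.
by rewrite invfM invr_expz.
Qed.

Lemma has_valM z k w l : has_val P t z k -> has_val P t w l -> has_val P t (z * w) (k + l).
Proof.
move=> [u uu ->] [v uv ->]; exists (u * v); first exact: place_unitM.
by rewrite expfzDr // mulrACA.
Qed.

Lemma has_val_unit u : place_unit P u -> has_val P t u 0.
Proof. by exists u => //; rewrite expr0z mul1r. Qed.

Lemma has_val_base : has_val P t t 1.
Proof. by exists 1; [apply: place_unit1|rewrite mulr1 expr1z]. Qed.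

Lemma has_valX z k n : has_val P t z k -> has_val P t (z ^+ n) (k * n%:Z).
Proof.
move=> h; elim: n => [|n IH]; first by rewrite expr0 mulr0; apply/has_val_unit/place_unit1.
by rewrite exprS -natz -addn1 natrD natz mulrDr mulr1 addrC; apply: has_valM.
Qed.

Lemma has_valXz z k (n : int) : has_val P t z k -> has_val P t (z ^ n) (k * n).
Proof.
move=> h; case: n => n; first exact: has_valX.
by rewrite NegzE mulrN -invr_expz; apply/has_valV/has_valX.
Qed.

Lemma has_val_place_ring z k : has_val P t z k -> place_ring P z -> 0 <= k.
Proof.
move=> h Oz; rewrite leNgt; apply/negP => k0.
have Iz : place_ideal P z^-1 by apply: has_val_ideal (has_valV h) _; rewrite oppr_gt0.
move/place_idealE: Iz; rewrite invrK; apply => //.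
by rewrite invr_eq0; apply: has_val_neq0 h.
Qed.

Lemma has_val_uniq z k l : has_val P t z k -> has_val P t z l -> k = l.
Proof.
suff le k' l' : has_val P t z k' -> has_val P t z l' -> l' <= k'.
  by move=> h h'; apply/eqP; rewrite eq_le !le.
move=> h h'; rewrite -subr_ge0.
apply: has_val_place_ring (has_valM h (has_valV h')) _.
by rewrite divff ?(has_val_neq0 h) //; apply: place1.
Qed.

(** The strict triangle equality: values being pairwise distinct, one term dominates, and divided by
    its power of [t] all the others fall into the ideal. *)
Lemma has_val_sum (I : finType) (f : I -> F) (k : I -> int) :
  (forall i, f i != 0 -> has_val P t (f i) (k i)) ->
  (forall i j, f i != 0 -> f j != 0 -> k i = k j -> i = j) ->
  (exists i, f i != 0) ->
  exists i, [/\ f i != 0, forall j, f j != 0 -> k i <= k j &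
    has_val P t (\sum_j f j) (k i)].
Proof.
move=> fk kinj [i0 fi0].
case: (arg_minP (P := fun i => f i != 0) k fi0) => i fi imin.
exists i; split=> //.
have [u uu fE] := fk _ fi.
exists (u + \sum_(j | j != i) t ^ (- k i) * f j); last first.
  rewrite mulrDr -fE (bigD1 i) //= mulr_sumr; congr (_ + _).
  by apply: eq_bigr => j _; rewrite mulrA -expfzDr // subrr mul1r.
apply: place_unitD => //; apply: place_ideal_sum => j ji.
have [->|fj] := eqVneq (f j) 0; first by rewrite mulr0; apply: place_ideal0.
have hb : has_val P t (t ^ (- k i)) (- k i).
  by rewrite -[X in has_val _ _ _ X]mul1r; apply/has_valXz/has_val_base.
apply: has_val_ideal (has_valM hb (fk _ fj)) _.
rewrite addrC subr_gt0 lt_neqAle imin // andbT.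
by apply: contra ji => /eqP /kinj ->.
Qed.

Hypothesis t_total : forall z, z != 0 -> exists k, has_val P t z k.

Lemma uniformizer_prime : prime_element P t.
Proof.
apply/seteqP; split=> [z Iz|_ [w Ow <-]]; last exact: place_idealM.
have [->|z0] := eqVneq z 0.
  by exists 0; [apply: place0|rewrite mulr0].
have [k hk] := t_total z0; exists (t^-1 * z); last by rewrite mulrA divff // mul1r.
apply: has_val_ring (has_valM (has_valV has_val_base) hk) _.
rewrite addrC subr_ge0 -gtz0_ge1 ltNge; apply/negP => k0.
move/(place_idealE P z0): Iz; apply; apply: has_val_ring (has_valV hk) _.
by rewrite oppr_ge0.
Qed.

(** The choice inside [nu] may use any prime element [s]. Since [s] and [t] generate the same ideal
    they differ by a unit, so every admissible exponent equals [k]. *)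
Lemma nu_has_val z k : has_val P t z k -> nu P z = k.
Proof.
move=> h; apply: xget_unique => /=.
  by case: h => u uu zE; exists t, u; split=> //; apply: uniformizer_prime.
move=> l [s [v [ps uv zE]]]; apply: has_val_uniq h.
have [w Ow tE] : exists2 w, place_ring P w & s * w = t by move: It; rewrite ps.
have Is : place_ideal P s.
  by rewrite ps; exists 1; [apply: place1|rewrite mulr1].
have [w' Ow' sE] : exists2 w, place_ring P w & t * w = s.
  by move: Is; rewrite uniformizer_prime.
have ww : w * w' = 1.
  apply: (mulfI t0); rewrite mulr1 -[RHS]tE -sE; ring.
have w'0 : w' != 0 by apply/eqP => w'0; move/eqP: ww; rewrite w'0 mulr0 eq_sym oner_eq0.
have uw' : place_unit P w'.
  split=> //; suff -> : w'^-1 = w by [].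
  by apply: (mulIf w'0); rewrite mulVf.
exists (w' ^ l * v); first by apply: place_unitM => //; apply: place_unitXz.
by rewrite zE -sE expfzMl mulrA.
Qed.

End Uniformizer.

End PlaceTheory.

(** * Function fields of the form y ^ M = h(x) *)

Section Evaluation.
Variables (K F : fieldType) (iota : {rmorphism K -> F}).

Definition evx (x : F) (g : {poly K}) : F := (map_poly iota g).[x].

Section Instances.
Variables (x y : F).

Fact evx_is_zmod_morphism : zmod_morphism (evx x).
Proof. by move=> g k; rewrite /evx rmorphB hornerD hornerN. Qed.
Fact evx_is_monoid_morphism : monoid_morphism (evx x).
Proof. by split=> [|g k]; rewrite /evx ?rmorph1 ?hornerC // rmorphM hornerM. Qed.
HB.instance Definition _ := GRing.isZmodMorphism.Build _ _ (evx x) evx_is_zmod_morphism.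
HB.instance Definition _ := GRing.isMonoidMorphism.Build _ _ (evx x) evx_is_monoid_morphism.

Fact eval_xy_is_zmod_morphism : zmod_morphism (eval_xy iota x y).
Proof. by move=> g k; rewrite /eval_xy rmorphB !hornerE. Qed.
Fact eval_xy_is_monoid_morphism : monoid_morphism (eval_xy iota x y).
Proof. by split=> [|g k]; rewrite /eval_xy ?rmorph1 ?hornerC // rmorphM !hornerM. Qed.
HB.instance Definition _ :=
  GRing.isZmodMorphism.Build _ _ (eval_xy iota x y) eval_xy_is_zmod_morphism.
HB.instance Definition _ :=
  GRing.isMonoidMorphism.Build _ _ (eval_xy iota x y) eval_xy_is_monoid_morphism.
End Instances.

Lemma evxC x k : evx x k%:P = iota k.
Proof. by rewrite /evx map_polyC hornerC. Qed.

Lemma evxX x : evx x 'X = x.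
Proof. by rewrite /evx map_polyX hornerX. Qed.

Lemma evx_XsubC x k : evx x ('X - k%:P) = x - iota k.
Proof. by rewrite rmorphB /= evxX evxC. Qed.

Lemma eval_xyC x y g : eval_xy iota x y g%:P = evx x g.
Proof. by rewrite /eval_xy map_polyC hornerC. Qed.

Lemma eval_xyX x y : eval_xy iota x y 'X = y.
Proof. by rewrite /eval_xy map_polyX hornerX hornerC. Qed.

Lemma eval_xyB x y (g k : {poly {poly K}}) :
  eval_xy iota x y (g - k) = eval_xy iota x y g - eval_xy iota x y k.
Proof. exact: raddfB. Qed.

Lemma eval_xyM x y (g k : {poly {poly K}}) :
  eval_xy iota x y (g * k) = eval_xy iota x y g * eval_xy iota x y k.
Proof. exact: rmorphM. Qed.

Lemma eval_xyE x y (g : {poly {poly K}}) n : (size g <= n)%N ->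
  eval_xy iota x y g = \sum_(i < n) evx x g`_i * y ^+ i.
Proof.
move=> sg; have gE : g = \sum_(i < n) (g`_i)%:P * 'X^i.
  rewrite -[LHS]coefK; apply/polyP => i; rewrite coef_poly coef_sum.
  under eq_bigr => j _ do rewrite mul_polyC coefZ coefXn.
  have [ig|gi] := ltnP i (size g).
    rewrite (bigD1 (Ordinal (leq_trans ig sg))) //= eqxx mulr1 big1 ?addr0 // => j.
    by rewrite -val_eqE /= eq_sym => /negbTE ->; rewrite mulr0.
  rewrite big1 // => j _; case: eqVneq => [<-|_]; last by rewrite mulr0.
  by rewrite nth_default // mul0r.
rewrite {1}gE rmorph_sum /=; apply: eq_bigr => i _.
by rewrite rmorphM rmorphXn /= eval_xyC eval_xyX.
Qed.

Lemma evx_ring (P : place iota) x (g : {poly K}) : place_ring P x -> place_ring P (evx x g).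
Proof.
move=> Ox; rewrite /evx horner_coef; apply: (subring_sum (place_subring P)) => i _.
by apply: place_mul; [rewrite coef_map; apply: place_const|apply: placeX].
Qed.

Definition place_over (x : F) (gamma : K) (P : place iota) : Prop :=
  place_ideal P (x - iota gamma).

Lemma lies_over_zeroW x gamma P : lies_over_zero x gamma P -> place_over x gamma P.
Proof.
move=> /(_ ('X - gamma%:P) 1); rewrite root_XsubC eqxx root1 => /(_ isT isT).
by rewrite -!/(evx x _) rmorph1 divr1 evx_XsubC.
Qed.

Section Over.
Variables (x : F) (gamma : K) (P : place iota).
Implicit Types (q : {poly K}).
Hypothesis hP : place_over x gamma P.

Lemma over_ring : place_ring P x.
Proof.
rewrite -[x](subrK (iota gamma)); apply: place_add; last exact: place_const.
by case: hP.
Qed.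

Lemma over_evx_ideal q : root q gamma -> place_ideal P (evx x q).
Proof.
move=> /factor_theorem [q1 ->]; rewrite rmorphM /= evx_XsubC mulrC.
by apply: place_idealM => //; apply/evx_ring/over_ring.
Qed.

Lemma place_unit_const k : k != 0 -> place_unit P (iota k).
Proof.
by move=> k0; split; rewrite -?fmorphV ?fmorph_eq0 //; apply: place_const.
Qed.

Lemma over_evx_unit q : ~~ root q gamma -> place_unit P (evx x q).
Proof.
move=> nq; have -> : q = (q.[gamma])%:P + (q - (q.[gamma])%:P) by rewrite addrC subrK.
rewrite rmorphD /= evxC; apply: place_unitD; first exact: place_unit_const.
by apply: over_evx_ideal; rewrite rootE !hornerE subrr.
Qed.

End Over.
End Evaluation.

Section Kummer.
Variables (K F : fieldType) (iota : {rmorphism K -> F}) (x y : F).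
Variables (M : nat) (h : {poly K}).
Hypotheses (M0 : (0 < M)%N) (h0 : h != 0).
Hypothesis hF : is_function_field iota x y ('X^M - h%:P).
Notation ex := (evx iota x).
Notation exy := (eval_xy iota x y).
Implicit Types (g : {poly {poly K}}).

(** This is the linear independence of [1, y, ..., y ^ (M - 1)] over [K(x)]. *)
Lemma eval_xy_eq0_small g : (size g <= M)%N -> exy g = 0 -> g = 0.
Proof.
move=> sg /(proj1 hF) [k gE]; move: sg; rewrite gE.
have [->|k0] := eqVneq k 0; first by rewrite mulr0.
rewrite mulrC size_Mmonic ?monicXnsubC // size_XnsubC // addnS /=.
by rewrite -{2}[M]add0n leq_add2r leqn0 size_poly_eq0 (negbTE k0).
Qed.

Lemma evx_eq0 (g : {poly K}) : ex g = 0 -> g = 0.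
Proof.
rewrite -(eval_xyC iota x y) => /eval_xy_eq0_small e; apply/eqP.
rewrite -polyC_eq0; apply/eqP/e.
by apply: leq_trans (size_polyC_leq1 _) _.
Qed.

Lemma evx_neq0 (g : {poly K}) : g != 0 -> ex g != 0.
Proof. by apply: contra => /eqP /evx_eq0 ->. Qed.

Lemma kummer_eq : y ^+ M = ex h.
Proof.
apply/eqP; rewrite -subr_eq0 -(eval_xyC iota x y) -{1}(eval_xyX iota x y).
rewrite -rmorphXn -rmorphB; apply/eqP/(proj1 hF); exists 1.
by rewrite mulr1.
Qed.

Lemma kummer_neq0 : y != 0.
Proof.
apply/eqP => y0; move/eqP: kummer_eq; rewrite y0 expr0n gtn_eqF //= eq_sym.
by rewrite (negbTE (evx_neq0 h0)).
Qed.

Lemma eval_xy_reduce g : exists2 g' : {poly {poly K}}, (size g' <= M)%N & exy g = exy g'.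
Proof.
have mf : ('X^M - h%:P) \is monic by rewrite monicXnsubC.
exists (Pdiv.Ring.rmodp g ('X^M - h%:P)).
  have := @Pdiv.Ring.ltn_rmodpN0 _ g _ (monic_neq0 mf).
  by rewrite size_XnsubC // ltnS.
rewrite {1}(Pdiv.RingMonic.rdivp_eq mf g) rmorphD rmorphM /=.
suff -> : exy ('X^M - h%:P) = 0 by rewrite mulr0 add0r.
by apply/(proj1 hF); exists 1; rewrite mulr1.
Qed.

(** A Bezout relation through the resultant, i.e. [g] is invertible modulo the curve equation over
    [K(x)]. The resultant is nonzero: a common factor [D] does not vanish at [(x, y)] because [g]
    does not, so its cofactor in the curve equation would vanish there with [y]-degree below [M]. *)
Lemma eval_xy_inv g : exy g != 0 -> exists v u r,
  r != 0 /\ v * g + u * ('X^M - h%:P) = r%:P.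
Proof.
set f := 'X^M - h%:P => g0.
have sf : size f = M.+1 by rewrite size_XnsubC.
have f0 : f != 0 by rewrite -size_poly_eq0 sf.
have ef : exy f = 0 by apply/(proj1 hF); exists 1; rewrite mulr1.
have sg1 : (1 < size g)%N \/ (size g <= 1)%N by case: ltnP; [left|right].
case: sg1 => [sg1|sg1]; last first.
  exists 1, 0, g`_0; rewrite mul1r mul0r addr0 -size1_polyC //; split=> //.
  by apply: contra g0 => /eqP g00; rewrite (size1_polyC sg1) g00 rmorph0.
have sf1 : (1 < size f)%N by rewrite sf.
have [[u v] _ rE] := resultant_in_ideal sf1 sg1.
exists v, u, (resultant f g); split; last by rewrite rE addrC.
rewrite resultant_eq0 -leqNgt leqNgt; apply/negP => sd.
set D := gcdp f g in sd.
have /Pdiv.WeakIdomain.dvdpP [[c E] /= c0 fE] := dvdp_gcdl f g.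
have /Pdiv.WeakIdomain.dvdpP [[c' E'] /= c'0 gE] := dvdp_gcdr f g.
have eC (k : {poly K}) : k != 0 -> exy k%:P != 0.
  by move=> k0; rewrite eval_xyC; apply: evx_neq0.
have eD : exy D != 0.
  apply: contra g0 => /eqP D0; move/eqP: (congr1 exy gE).
  by rewrite -mul_polyC !rmorphM /= -/D D0 mulr0 mulf_eq0 (negbTE (eC _ c'0)).
have eE : exy E = 0.
  move/eqP: (congr1 exy fE); rewrite -mul_polyC !rmorphM /= ef mulr0 eq_sym mulf_eq0.
  by rewrite (negbTE eD) orbF => /eqP.
have E0 : E != 0.
  apply/eqP => E0; move/eqP: fE.
  by rewrite E0 mul0r -mul_polyC mulf_eq0 polyC_eq0 (negbTE c0) (negbTE f0).
have [/eqP nE0] := E0; apply: nE0; apply: eval_xy_eq0_small => //.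
have D0 : D != 0 by apply: contra eD => /eqP ->; rewrite rmorph0.
have := congr1 (fun p : {poly {poly K}} => size p) fE.
rewrite /= size_scale // sf size_mul //.
by case: (size D) sd => [|[|n]] // _; rewrite !addnS /= => -[->]; rewrite leq_addr.
Qed.

(* Negative powers of [y], because [-nu] of [y^-i] is [i] at the places above the
   roots of [t]. *)
Lemma kummer_decomp z : exists (r : {poly K}) (g : 'I_M -> {poly K}),
  r != 0 /\ z = \sum_i ex (g i) / ex r * y ^- i.
Proof.
(* Expanding [z y ^ (M - 1)] in the powers [y ^ 0, ..., y ^ (M - 1)] and dividing back produces
   exactly the exponents [0, ..., -(M - 1)]. *)
have [g [k [k0 zE]]] := proj2 hF (z * y ^+ M.-1).
have [v [u [r [r0 rE]]]] := eval_xy_inv k0.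
have ef : exy ('X^M - h%:P) = 0 by apply/(proj1 hF); exists 1; rewrite mulr1.
have vk : exy v * exy k = ex r.
  by rewrite -(eval_xyC iota x y) -rE rmorphD !rmorphM /= ef mulr0 addr0.
have [g' sg' gE] := eval_xy_reduce (g * v).
have y0 := kummer_neq0.
exists r, (fun i => g'`_(M - i.+1)); split=> //.
have er0 := evx_neq0 r0.
have v0 : exy v != 0 by apply: contra er0 => /eqP v0; rewrite -vk v0 mul0r.
have -> : z = exy (g * v) / ex r * y ^- M.-1.
  rewrite rmorphM -vk invfM /= -[LHS](mulfK (expf_neq0 M.-1 y0)) zE.
  by field; rewrite k0 v0 expf_neq0.
rewrite gE (eval_xyE _ _ _ sg') (reindex_inj rev_ord_inj) /= !mulr_suml.
apply: eq_bigr => i _; rewrite -!mulrA; congr (_ * _).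
have -> : y ^+ M.-1 = y ^+ (M - i.+1) * y ^+ i.
  by rewrite -exprD; congr (_ ^+ _); case: (M) i => [[]//|m] i /=; rewrite subSS subnK // leq_ord.
by field; rewrite er0 !expf_neq0.
Qed.

End Kummer.

Definition simple_root (K : fieldType) (h : {poly K}) (gamma : K) : Prop :=
  exists2 h1, h = h1 * ('X - gamma%:P) & ~~ root h1 gamma.

Lemma place_avoiding (K F : fieldType) (iota : {rmorphism K -> F}) (A : set F) z :
  is_subring A -> (forall k, A (iota k)) -> ~ A z -> A z^-1 ->
  exists P : place iota, A `<=` place_ring P /\ ~ place_ring P z.
Proof.
move=> hA Ak nAz Azi; have [V [hV AV nVz totV]] := valuation_ring_avoiding hA nAz Azi.
have Vk k : V (iota k) by apply: AV.
have propV : V <> setT by move=> VT; apply: nVz; rewrite VT.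
by exists (Place Vk (subringD hV) (subringM hV) propV totV).
Qed.

Lemma eq_mulB_lt (M i j : nat) (k l : int) : (i < M)%N -> (j < M)%N ->
  M%:Z * k - i%:Z = M%:Z * l - j%:Z -> i = j.
Proof.
move=> iM jM e; have [kl|kl|kl] := ltgtP k l; last by move: e; rewrite kl; lia.
  have [d dE] : exists d : nat, l = k + 1 + d%:Z by exists `|(l - k - 1)%R|%N; lia.
  by move: e; rewrite dE; nia.
have [d dE] : exists d : nat, k = l + 1 + d%:Z by exists `|(k - l - 1)%R|%N; lia.
by move: e; rewrite dE; nia.
Qed.

Section KummerPlaces.
Variables (K F : fieldType) (iota : {rmorphism K -> F}) (x y : F).
Variables (M : nat) (h : {poly K}).
Hypotheses (M0 : (0 < M)%N) (h0 : h != 0).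
Hypothesis hF : is_function_field iota x y ('X^M - h%:P).
Notation ex := (evx iota x).
Notation exy := (eval_xy iota x y).

Section Totally.
Variables (gamma : K).
Hypothesis hgamma : simple_root h gamma.
Notation over := (place_over x gamma).

Let y0 := kummer_neq0 M0 h0 hF.

Lemma over_y_ideal (P : place iota) : over P -> place_ideal P y.
Proof.
move=> hP; have IyM : place_ideal P (y ^+ M).
  rewrite (kummer_eq hF); apply: (over_evx_ideal hP).
  by case: hgamma => h1 -> _; rewrite rootM root_XsubC eqxx orbT.
split; first by apply: (place_root M0); case: IyM.
by move=> /(place_unitX M) /place_unit_ideal.
Qed.

(** As [gamma] is a simple root, [y ^ M = h(x)] is a unit times [x - gamma]. This is total
    ramification, with [y] as uniformizer. *)
Lemma over_XsubC_val (P : place iota) : over P -> has_val P y (x - iota gamma) M.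
Proof.
move=> hP; case: hgamma => h1 hE nr; exists (ex h1)^-1.
  by apply: place_unitV; apply: over_evx_unit nr.
rewrite -exprnP (kummer_eq hF) hE rmorphM /= evx_XsubC mulrAC mulfV ?mul1r //.
by have [] := over_evx_unit hP nr.
Qed.

(** [m] is chosen before [P]: the value depends on [gamma] alone, which later yields uniqueness of
    the place over [gamma]. *)
Lemma over_evx_val (g : {poly K}) : g != 0 ->
  exists m : int, forall P : place iota, over P -> has_val P y (ex g) (M%:Z * m).
Proof.
move=> g0; have [m [q]] := multiplicity_XsubC g gamma.
rewrite g0 /= => nr ->; exists m => P hP.
rewrite rmorphM rmorphXn /= evx_XsubC -[X in has_val _ _ _ X]add0r.
apply: (has_valM y0); first by apply: has_val_unit; apply: (over_evx_unit hP).
by apply: (has_valX y0); apply: over_XsubC_val.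
Qed.

Lemma over_term_val (g r : {poly K}) (i : nat) : g != 0 -> r != 0 ->
  exists m : int, forall P : place iota, over P ->
    has_val P y (ex g / ex r * y ^- i) (M%:Z * m - i%:Z).
Proof.
move=> g0 r0; have [m hm] := over_evx_val g0; have [n hn] := over_evx_val r0.
exists (m - n) => P hP; rewrite mulrBr.
apply: (has_valM y0).
  by apply: (has_valM y0); [apply: hm|apply: has_valV; apply: hn].
apply: has_valV; rewrite -[X in has_val _ _ _ X]mul1r.
by apply: (has_valX y0); apply: has_val_base.
Qed.

(** The term of index [i] has value congruent to [-i] modulo [M], so no two nonzero terms share a
    value and nothing cancels. *)
Lemma over_val_decomp (r : {poly K}) (g : 'I_M -> {poly K}) z :
  r != 0 -> z = \sum_i ex (g i) / ex r * y ^- i -> z != 0 ->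
  exists (m : 'I_M -> int) (i0 : 'I_M), [/\ g i0 != 0,
    forall i, g i != 0 -> M%:Z * m i0 - i0%:Z <= M%:Z * m i - i%:Z &
    forall P : place iota, over P -> has_val P y z (M%:Z * m i0 - i0%:Z) /\
      forall i, g i != 0 ->
        has_val P y (ex (g i) / ex r * y ^- i) (M%:Z * m i - i%:Z)].
Proof.
move=> r0 zE z0.
have /choice [m hm] : forall i : 'I_M, exists m : int, g i != 0 ->
    forall P : place iota, over P ->
      has_val P y (ex (g i) / ex r * y ^- i) (M%:Z * m - i%:Z).
  move=> i; have [gi|gi] := eqVneq (g i) 0; first by exists 0.
  by have [m hm] := over_term_val i gi r0; exists m.
have fg i : (ex (g i) / ex r * y ^- i != 0) = (g i != 0).
  rewrite !mulf_eq0 !invr_eq0 expf_eq0 (negbTE y0) andbF orbF.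
  rewrite (negbTE (evx_neq0 M0 hF r0)) orbF.
  by have [->|gi] := eqVneq (g i) 0; rewrite ?rmorph0 ?eqxx // (evx_neq0 M0 hF gi).
have [i1 gi1] : exists i, g i != 0.
  apply/not_existsP => none; move/eqP: z0; apply; rewrite zE big1 // => i _.
  by have /negP/negPn/eqP -> := none i; rewrite rmorph0 !mul0r.
case: (arg_minP (P := fun i => g i != 0) (fun i => M%:Z * m i - i%:Z) gi1) => i0 gi0 imin.
exists m, i0; split=> // P hP; split; last by move=> i gi; apply: hm.
have := @has_val_sum _ _ _ P y y0 (over_y_ideal hP) _
  (fun i => ex (g i) / ex r * y ^- i) (fun i => M%:Z * m i - i%:Z).
case.
- by move=> i; rewrite fg => gi; apply: hm.
- by move=> i j _ _ e; apply/val_inj/(eq_mulB_lt (ltn_ord i) (ltn_ord j) e).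
- by exists i1; rewrite fg.
move=> i []; rewrite fg => gi lei; rewrite -zE => hz.
have -> // : M%:Z * m i0 - i0%:Z = M%:Z * m i - i%:Z.
by apply/eqP; rewrite eq_le imin //= lei // fg.
Qed.

Lemma over_val_total z : z != 0 ->
  exists k : int, forall P : place iota, over P -> has_val P y z k.
Proof.
move=> z0; have [r [g [r0 zE]]] := kummer_decomp M0 h0 hF z.
have [m [i0 [_ _ hP]]] := over_val_decomp r0 zE z0.
by exists (M%:Z * m i0 - i0%:Z) => P /hP [].
Qed.

(** All places over [gamma] give each function the same value, and the ring consists of [0] and the
    functions of nonnegative value. *)
Lemma over_uniq (P P' : place iota) : over P -> over P' -> P = P'.
Proof.
suff sub (P1 P2 : place iota) : over P1 -> over P2 -> place_ring P1 `<=` place_ring P2.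
  by move=> h1 h2; apply: place_eq; apply/seteqP; split; apply: sub.
move=> h1 h2 z Oz; have [->|z0] := eqVneq z 0; first exact: place0.
have [k hk] := over_val_total z0.
apply: has_val_ring (hk _ h2) _ => //; first exact: over_y_ideal.
by apply: has_val_place_ring (hk _ h1) Oz => //; apply: over_y_ideal.
Qed.

Lemma over_nu (P : place iota) z k : over P -> has_val P y z k -> nu P z = k.
Proof.
move=> hP; apply: nu_has_val => //; first exact: over_y_ideal.
by move=> w w0; have [l hl] := over_val_total w0; exists l; apply: hl.
Qed.

End Totally.

Lemma kummer_automorphism (y' : F) : y' ^+ M = ex h ->
  exists sigma : {rmorphism F -> F}, (forall g, sigma (ex g) = ex g) /\ sigma y = y'.
Proof.
move=> y'M; have fz : eval_xy iota x y' ('X^M - h%:P) = 0.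
  by rewrite eval_xyB rmorphXn /= eval_xyX eval_xyC y'M subrr.
have ef : exy ('X^M - h%:P) = 0 by apply/(proj1 hF); exists 1; rewrite mulr1.
have ezy0 g : exy g = 0 -> eval_xy iota x y' g = 0.
  by move=> /(proj1 hF) [k ->]; rewrite eval_xyM /= fz mul0r.
(* Denominators survive the substitution of [y'] for [y]: the relation of [eval_xy_inv] still holds
   at [y'], and its right side [r(x)] is nonzero. *)
have ezyN0 g : exy g != 0 -> eval_xy iota x y' g != 0.
  move=> /(eval_xy_inv M0 hF) [v [u [r [r0 rE]]]].
  move/(congr1 (eval_xy iota x y')): rE; rewrite rmorphD /= !eval_xyM fz mulr0 addr0 eval_xyC.
  move=> e; have := evx_neq0 M0 hF r0; rewrite -e.
  by apply: contra => /eqP ->; rewrite mulr0.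
have /choice [sigma hs] : forall z, exists w, exists g k,
    [/\ exy k != 0, z = exy g / exy k & w = eval_xy iota x y' g / eval_xy iota x y' k].
  move=> z; have [g [k [k0 zE]]] := proj2 hF z.
  by exists (eval_xy iota x y' g / eval_xy iota x y' k), g, k.
have sE g k : exy k != 0 -> sigma (exy g / exy k) = eval_xy iota x y' g / eval_xy iota x y' k.
  move=> k0; have [g' [k' [k'0 e ->]]] := hs (exy g / exy k).
  apply/eqP; rewrite eq_sym eqr_div ?ezyN0 // -subr_eq0.
  rewrite -!eval_xyM -eval_xyB.
  apply/eqP/ezy0; rewrite eval_xyB !eval_xyM; apply/eqP.
  by rewrite subr_eq0 -eqr_div // e.
have s1 g : sigma (exy g) = eval_xy iota x y' g.
  have := sE g 1; rewrite !rmorph1 !divr1; apply; exact: oner_neq0.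
have rep z : exists g k, exy k != 0 /\ z = exy g / exy k by apply: (proj2 hF).
have sB : zmod_morphism sigma.
  move=> z w; have [g [k [k0 ->]]] := rep z; have [g' [k' [k'0 ->]]] := rep w.
  have -> : exy g / exy k - exy g' / exy k' = exy (g * k' - g' * k) / exy (k * k').
    by rewrite eval_xyB !eval_xyM; field; rewrite k0 k'0.
  have kk0 : exy (k * k') != 0 by rewrite eval_xyM mulf_neq0.
  rewrite !sE // eval_xyB !eval_xyM.
  by field; rewrite !ezyN0.
have sM : monoid_morphism sigma.
  split; first by have := s1 1; rewrite !rmorph1.
  move=> z w; have [g [k [k0 ->]]] := rep z; have [g' [k' [k'0 ->]]] := rep w.
  have -> : exy g / exy k * (exy g' / exy k') = exy (g * g') / exy (k * k').
    by rewrite !eval_xyM; field; rewrite k0 k'0.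
  have kk0 : exy (k * k') != 0 by rewrite eval_xyM mulf_neq0.
  rewrite !sE // !eval_xyM.
  by field; rewrite !ezyN0.
exists (HB.pack sigma (GRing.isZmodMorphism.Build _ _ sigma sB)
  (GRing.isMonoidMorphism.Build _ _ sigma sM) : {rmorphism F -> F}); split => /=.
- by move=> g; rewrite -(eval_xyC iota x y) s1 !eval_xyC.
- by rewrite -[in LHS](eval_xyX iota x y) s1 eval_xyX.
Qed.

End KummerPlaces.

(** * Divisibility by separable polynomials and places at infinity *)

(** Write [p = e g] with [g] the gcd of [p] and [A]. Separability makes [e] prime to [g], hence to
    [A]; as [e] divides [A ^ n], it is constant. *)
Lemma separable_dvdp_exp (K : fieldType) (p A : {poly K}) n :
  separable_poly p -> p %| A ^+ n -> p %| A.
Proof.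
move=> sp pA; have /dvdpP [e pE] := dvdp_gcdl p A.
have ceg : coprimep e (gcdp p A) by move: sp; rewrite {1}pE separable_mul => /and3P [].
have ceA : coprimep e A.
  apply/coprimepP => d de dA; have dg : d %| gcdp p A.
    by rewrite dvdp_gcd dA andbT pE dvdp_mulr.
  by move/coprimepP: ceg; apply.
have e1 : size e == 1%N.
  rewrite -dvdp1 -(Gauss_dvdpr 1 (coprimep_expr n ceA)) mulr1.
  by apply: dvdp_trans pA; rewrite pE dvdp_mulr.
have /size_poly1P [k k0 eE] := e1.
by rewrite pE eE mul_polyC dvdpZl // dvdp_gcdr.
Qed.

(** The inequality says [c <= ceil(i / m)]: every irreducible factor of [E] has multiplicity at
    least [i / m] in [A]. The induction peels off one copy of [E], which lowers [i] by [m]. *)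
Lemma separable_exp_dvdp_exp (K : fieldType) (E : {poly K}) m :
  (0 < m)%N -> separable_poly E -> forall c i (A : {poly K}), (c * m < i + m)%N ->
  E ^+ i %| A ^+ m -> E ^+ c %| A.
Proof.
move=> m0 sE; have E0 : E != 0 by apply: separable_poly_neq0.
elim=> [|c IH] i A ci EA; first by rewrite expr0 dvd1p.
have i0 : (0 < i)%N by nia.
have /dvdpP [A' AE] : E %| A.
  by apply: separable_dvdp_exp (dvdp_trans _ EA) => //; rewrite -(prednK i0) exprS dvdp_mulr.
(* The subtraction is truncated: for [i <= m] the remaining exponent is [0] and divisibility is
   trivial. *)
rewrite AE exprSr dvdp_mul2r //; apply: (IH (i - m)%N); first by nia.
have [im|/ltnW mi] := leqP i m.
  by move: im; rewrite -subn_eq0 => /eqP ->; rewrite expr0 dvd1p.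
by move: EA; rewrite AE exprMn -{1}(subnK mi) exprD dvdp_mul2r // expf_neq0.
Qed.

Section HasVal.
Variables (K F : fieldType) (iota : {rmorphism K -> F}) (P : place iota) (t : F).

Lemma has_val_prod (t0 : t != 0) (I : Type) (r : seq I) (f : I -> F) (v : I -> int) :
  (forall i, has_val P t (f i) (v i)) -> has_val P t (\prod_(i <- r) f i) (\sum_(i <- r) v i).
Proof.
move=> h; elim: r => [|i r IH]; first by rewrite !big_nil; apply/has_val_unit/place_unit1.
by rewrite !big_cons; apply: has_valM.
Qed.
End HasVal.

Section Infinity.
Variables (K F : fieldType) (iota : {rmorphism K -> F}) (x : F).
Notation ex := (evx iota x).

Lemma infinity_ideal (P : place iota) : ~ place_ring P x -> place_ideal P x^-1.
Proof.
move=> nx; have x0 : x != 0 by apply/eqP => x0; apply: nx; rewrite x0; apply: place0.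
by apply/place_idealE; rewrite ?invr_eq0 // invrK.
Qed.

(** Divided by the top power of [x], every term but the leading one lies in the ideal. Measuring
    against [x^-1] is enough to compare degrees, whatever the ramification at infinity. *)
Lemma infinity_val (P : place iota) (A : {poly K}) : ~ place_ring P x -> A != 0 ->
  has_val P x^-1 (ex A) (- (size A).-1%:Z).
Proof.
move=> nx A0; have Ix := infinity_ideal nx.
have x0 : x != 0 by apply/eqP => x0; apply: nx; rewrite x0; apply: place0.
exists (ex A * x ^- (size A).-1); last first.
  by rewrite exprz_inv opprK -exprnP mulrC mulfVK ?expf_neq0.
rewrite /evx horner_coef size_map_poly (polySpred A0) /= big_ord_recr /= mulrDl addrC.
rewrite mulfK ?expf_neq0 // coef_map; apply: place_unitD.
  by apply: place_unit_const; rewrite -lead_coefE lead_coef_eq0.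
rewrite mulr_suml; apply: place_ideal_sum => i _.
have -> : x ^- (size A).-1 = x ^- i * x^-1 * x^-1 ^+ ((size A).-1 - i.+1).
  rewrite -!exprVn -exprSr -exprD; congr (_ ^+ _).
  by rewrite subnKC.
rewrite coef_map -(mulrA (x ^- i)) [_ * (x ^- i * _)]mulrA mulfK ?expf_neq0 // mulrCA.
apply: place_idealM => //; apply: place_mul; first exact: place_const.
by apply: placeX; case: Ix.
Qed.

Lemma infinity_place : (forall g : {poly K}, ex g = 0 -> g = 0) ->
  exists P : place iota, ~ place_ring P x.
Proof.
move=> inj; pose C := [set iota k | k in [set: K]].
have hC : is_subring C.
  split; first by exists 1; rewrite ?rmorph1.
    by move=> _ _ [k _ <-] [l _ <-]; exists (k - l); rewrite ?rmorphB.
  by move=> _ _ [k _ <-] [l _ <-]; exists (k * l); rewrite ?rmorphM.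
have x0 : x != 0.
  by apply/eqP => x0; have := inj 'X; rewrite evxX => /(_ x0) /eqP; rewrite polyX_eq0.
(* A valuation ring containing [K[x^-1]] but not [x] is a pole of [x]. A relation [x = p(x^-1)]
   times [x ^ n] would be a monic equation for [x], against transcendence. *)
suff nAx : ~ adjoin C x^-1 x.
  have [k||P [_ nP]] := place_avoiding (iota := iota) (adjoin_subring hC x^-1) _ nAx.
  - by apply: sub_adjoin => //; exists k.
  - exact: adjoin_gen.
  by exists P.
move=> [p Cp xE]; set n := size p.
  have /choice [k kE] : forall i, exists k, iota k = p`_i.
    by move=> i; have [k _ <-] := Cp i; exists k.
  have : ex ('X^(n.+1) - \poly_(i < n.+1) k (n - i)%N) = 0.
    rewrite raddfB /= rmorphXn /= evxX /evx.
    have sp : (size (map_poly iota (\poly_(i < n.+1) k (n - i)%N)) <= n.+1)%N.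
      by rewrite size_map_poly size_poly.
    rewrite (horner_coef_wide _ sp) exprS {1}xE (horner_coef_wide _ (leqnSn n)).
    rewrite mulr_suml (reindex_inj rev_ord_inj) /=; apply/eqP; rewrite subr_eq0; apply/eqP.
    apply: eq_bigr => i _; rewrite coef_map coef_poly ltn_ord subSS /= kE.
    have -> : x ^+ n = x ^+ (n - i) * x ^+ i by rewrite -exprD subnK // leq_ord.
    by rewrite exprVn mulrA mulfVK // expf_neq0.
  move/inj/(congr1 (fun q : {poly K} => q`_n.+1)).
  rewrite coefB coefXn eqxx coef_poly ltnn subr0 coef0 => /eqP.
  by rewrite oner_eq0.
Qed.

End Infinity.

(** * Kummer components *)

Section KummerSemigroup.
Variables (K F : fieldType) (iota : {rmorphism K -> F}) (x y : F).
Variables (M : nat) (h : {poly K}) (zeta : K).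
Variables (N : nat) (Q : 'I_N -> place iota) (gam : 'I_N -> K).
Hypotheses (M0 : (0 < M)%N) (h0 : h != 0).
Hypothesis hF : is_function_field iota x y ('X^M - h%:P).
Hypotheses (hM : (M%:R : K) != 0) (hzeta : M.-primitive_root zeta).
Hypothesis (hQ : forall k, place_over x (gam k) (Q k)).
Hypothesis (hgam : forall k, simple_root h (gam k)).
Notation ex := (evx iota x).
Let y0 := kummer_neq0 M0 h0 hF.

Lemma outside_not_over (P : place iota) k : ~ range Q P -> ~ place_over x (gam k) P.
Proof. by move=> nP hP; apply: nP; exists k => //; apply: (over_uniq M0 h0 hF (hgam k)). Qed.

Lemma XsubC_neq0 k : x - iota (gam k) != 0.
Proof. by rewrite -evx_XsubC (evx_neq0 M0 hF) // polyXsubC_eq0. Qed.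

Lemma outside_unit (P : place iota) k : ~ range Q P -> place_ring P x ->
  place_unit P (x - iota (gam k)).
Proof.
move=> nP Ox; apply/not_notP => nu; apply: (outside_not_over nP (k := k)).
by split=> //; apply: place_add => //; apply: placeN; apply: place_const.
Qed.

Lemma place_pullback (sigma : {rmorphism F -> F}) (P : place iota) :
  (forall k, sigma (iota k) = iota k) -> (forall v, exists w, sigma w = v) ->
  exists P' : place iota, forall w, place_ring P' w <-> place_ring P (sigma w).
Proof.
move=> sk ss; pose V := [set w | place_ring P (sigma w)].
have V1 k : V (iota k) by rewrite /V /= sk; apply: place_const.
have V2 z w : V z -> V w -> V (z + w) by rewrite /V /= rmorphD; apply: place_add.
have V3 z w : V z -> V w -> V (z * w) by rewrite /V /= rmorphM; apply: place_mul.
have V4 : V <> setT.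
  move=> VT; apply: (@place_proper _ _ _ P); apply/seteqP; split=> // v _.
  by have [w <-] := ss v; have : [set: F] w by []; rewrite -VT.
have V5 z : V z \/ V z^-1 by rewrite /V /= fmorphV; apply: place_total.
by exists (Place V1 V2 V3 V4 V5).
Qed.

(** [sigma] fixes [x], so the pullback of [P] can lie over some [gam k] only if [P] does; places
    outside [Q] pull back to places outside [Q]. *)
Lemma regular_conj (sigma : {rmorphism F -> F}) z :
  (forall g, sigma (ex g) = ex g) -> (forall v, exists w, sigma w = v) ->
  regular_outside Q z -> regular_outside Q (sigma z).
Proof.
move=> sx ss Rz P nP.
have sk k : sigma (iota k) = iota k by rewrite -(evxC iota x) sx.
have [P' hP'] := place_pullback P sk ss.
apply/hP'/Rz => -[k _ QP']; apply: (outside_not_over nP (k := k)).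
have x0 := XsubC_neq0 k; apply/(place_idealE P x0) => OP.
have := hQ k; rewrite QP' => /(place_idealE P' x0); apply; apply/hP'.
by rewrite -(evx_XsubC iota x) fmorphV sx evx_XsubC.
Qed.

Lemma sum_primitive_root i k : (i < M)%N -> (k < M)%N ->
  \sum_(j < M) (zeta ^+ k / zeta ^+ i) ^+ j = if i == k then M%:R else 0.
Proof.
move=> iM kM; have z0 : zeta != 0 by rewrite (prim_root_eq0 hzeta) -lt0n.
have [->|ik] := eqVneq i k.
  rewrite divff ?expf_neq0 //; under eq_bigr do rewrite expr1n.
  by rewrite sumr_const card_ord.
set w := _ / _; have w1 : w != 1.
  rewrite -subr_eq0 -(inj_eq (mulIf (expf_neq0 i z0))) mul0r mulrBl mul1r.
  rewrite mulfVK ?expf_neq0 // subr_eq0 (eq_prim_root_expr hzeta) !modn_small //.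
  by rewrite eq_sym.
apply/eqP; have := subrX1 w M.
have -> : w ^+ M = 1.
  by rewrite expr_div_n -!exprM ![(_ * M)%N]mulnC !exprM (prim_expr_order hzeta) !expr1n divr1.
by rewrite subrr => /eqP; rewrite eq_sym mulf_eq0 subr_eq0 (negbTE w1).
Qed.

(* Projection on the [zeta^-i]-eigenspace of the Kummer group, which permutes the
   places outside [Q]. *)
Lemma regular_component (r : {poly K}) (g : 'I_M -> {poly K}) z :
  r != 0 -> z = \sum_i ex (g i) / ex r * y ^- i -> regular_outside Q z ->
  forall i, regular_outside Q (ex (g i) / ex r * y ^- i).
Proof.
move=> r0 zE Rz k; have z0 : zeta != 0 by rewrite (prim_root_eq0 hzeta) -lt0n.
have /choice [sigma hs] : forall j : nat, exists sigma : {rmorphism F -> F},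
    (forall g, sigma (ex g) = ex g) /\ sigma y = iota (zeta ^+ j) * y.
  move=> j; apply: (kummer_automorphism M0 hF).
  rewrite exprMn -rmorphXn -exprM mulnC exprM (prim_expr_order hzeta) expr1n rmorph1.
  by rewrite mul1r (kummer_eq hF).
have sk j c : sigma j (iota c) = iota c by rewrite -(evxC iota x) (hs j).1.
have sE j (r' : {poly K}) (g' : 'I_M -> {poly K}) (c : 'I_M -> K) :
    sigma j (\sum_i iota (c i) * (ex (g' i) / ex r' * y ^- i)) =
    \sum_i iota (c i / (zeta ^+ j) ^+ i) * (ex (g' i) / ex r' * y ^- i).
  rewrite rmorph_sum; apply: eq_bigr => i _.
  have -> : iota (c i / (zeta ^+ j) ^+ i) = iota (c i) / iota (zeta ^+ j) ^+ i.
    by rewrite fmorph_div !(rmorphXn iota).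
  rewrite !(rmorphM (sigma j)) !(fmorphV (sigma j)) (rmorphXn (sigma j)) /= sk !(hs j).1.
  by rewrite (hs j).2 exprMn invfM; ring.
(* Preimages come from rescaling the component of index [i] by [zeta ^ (j i)]. Surjectivity keeps
   the pullback of a place a proper subring. *)
have sS j v : exists w, sigma j w = v.
  have [r' [g' [_ ->]]] := kummer_decomp M0 h0 hF v.
  exists (\sum_(i < M) iota ((zeta ^+ j) ^+ i) * (ex (g' i) / ex r' * y ^- i)).
  rewrite (sE j r' g' (fun i => (zeta ^+ j) ^+ i));
  apply: eq_bigr => i _; rewrite divff ?rmorph1 ?mul1r //.
  by rewrite !expf_neq0.
have Rj j : regular_outside Q (sigma j z).
  by apply: regular_conj Rz; [case: (hs j)|apply: sS].
(* [sigma j] multiplies the component of index [i] by [zeta ^ (- i j)]; averaging against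
   [zeta ^ (k j)] isolates index [k] by orthogonality. *)
have -> : ex (g k) / ex r * y ^- k =
    iota (M%:R^-1) * \sum_(j < M) iota ((zeta ^+ k) ^+ j) * sigma j z.
  have sz j : sigma j z = \sum_(i < M) iota (1 / (zeta ^+ j) ^+ i) * (ex (g i) / ex r * y ^- i).
    rewrite -(sE j r g (fun=> 1)) zE; congr (sigma j _); apply: eq_bigr => i _.
    by rewrite rmorph1 mul1r.
  under eq_bigr => j _ do rewrite sz mulr_sumr.
  rewrite exchange_big /=.
  have -> : \sum_(i < M) \sum_(j < M) iota ((zeta ^+ k) ^+ j) *
      (iota (1 / (zeta ^+ j) ^+ i) * (ex (g i) / ex r * y ^- i)) =
    \sum_(i < M) iota (if i == k then M%:R else 0) * (ex (g i) / ex r * y ^- i).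
    apply: eq_bigr => i _; rewrite -val_eqE -(sum_primitive_root (ltn_ord i) (ltn_ord k)).
    rewrite rmorph_sum mulr_suml; apply: eq_bigr => j _.
    rewrite mulrA -rmorphM; congr (iota _ * _).
    by rewrite div1r expr_div_n -!exprM [(i * j)%N]mulnC.
  rewrite (bigD1 k) //= eqxx big1 ?addr0; last first.
    by move=> i /negbTE ->; rewrite rmorph0 mul0r.
  by rewrite mulrA -rmorphM mulVf // rmorph1 mul1r.
move=> P nP; apply: place_mul; first exact: place_const.
apply: (subring_sum (place_subring P)) => j _; apply: place_mul; first exact: place_const.
exact: Rj.
Qed.

End KummerSemigroup.

(** * Functions with poles in a prescribed finite set *)

Section RationalFunctions.
Variables (K F : fieldType) (iota : {rmorphism K -> F}) (x : F).
Notation ex := (evx iota x).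
Hypothesis ex_inj : forall g : {poly K}, ex g = 0 -> g = 0.

Lemma evx_nz (g : {poly K}) : g != 0 -> ex g != 0.
Proof. by apply: contra => /eqP /ex_inj ->. Qed.

Definition rational (z : F) : Prop :=
  exists A B : {poly K}, [/\ B != 0, coprimep A B & z = ex A / ex B].

Lemma rational_frac (A B : {poly K}) : B != 0 -> rational (ex A / ex B).
Proof.
move=> B0; have g0 : gcdp A B != 0 by rewrite gcdp_eq0 negb_and B0 orbT.
exists (A %/ gcdp A B), (B %/ gcdp A B); split.
- by rewrite divp_eq0 (negbTE B0) (negbTE g0) /= -leqNgt leq_gcdpr.
- by apply: coprimep_div_gcd; rewrite B0 orbT.
rewrite -[in LHS](divpK (dvdp_gcdl A B)) -[in X in _ / X](divpK (dvdp_gcdr A B)).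
by rewrite !rmorphM /= -mulf_div divff ?mulr1 // evx_nz.
Qed.

Lemma rationalM z w : rational z -> rational w -> rational (z * w).
Proof.
move=> [A [B [B0 _ ->]]] [C [D [D0 _ ->]]].
by rewrite mulf_div -!rmorphM; apply: rational_frac; rewrite mulf_neq0.
Qed.

Lemma rationalV z : rational z -> rational z^-1.
Proof.
move=> [A [B [B0 _ ->]]]; rewrite invf_div.
have [->|A0] := eqVneq A 0; last exact: rational_frac.
rewrite rmorph0 invr0 mulr0 -(mul0r (ex 1)^-1) -(rmorph0 (evx iota x)).
exact/rational_frac/oner_neq0.
Qed.

Lemma rational_evx g : rational (ex g).
Proof. by rewrite -[ex g]divr1 -(rmorph1 (evx iota x)); apply/rational_frac/oner_neq0. Qed.

Lemma rationalX z n : rational z -> rational (z ^+ n).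
Proof.
move=> rz; elim: n => [|n IH]; last by rewrite exprS; apply: rationalM.
by rewrite expr0 -(rmorph1 (evx iota x)); apply: rational_evx.
Qed.

Lemma rationalXz z (n : int) : rational z -> rational (z ^ n).
Proof.
move=> rz; case: n => n; first exact: rationalX.
exact: rationalV (rationalX n.+1 rz).
Qed.

Lemma rational_prod (I : Type) (r : seq I) (f : I -> F) :
  (forall i, rational (f i)) -> rational (\prod_(i <- r) f i).
Proof.
move=> h; elim/big_ind: _ => //; last exact: rationalM.
by rewrite -(rmorph1 (evx iota x)); apply: rational_evx.
Qed.

(** The base ring for a place above some factor of [B]: all polynomials prime to [B] are units in
    it. *)
Lemma localization_subring (B : {poly K}) :
  is_subring [set z | exists f g : {poly K}, [/\ g != 0, coprimep g B & z = ex f / ex g]].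
Proof.
split.
- exists 1, 1; rewrite oner_neq0 rmorph1 divr1; split=> //; exact: coprime1p.
- move=> _ _ [f [g [g0 gB ->]]] [f' [g' [g'0 g'B ->]]].
  exists (f * g' - f' * g), (g * g'); rewrite mulf_neq0 // coprimepMl gB g'B; split=> //.
  by rewrite -mulNr addf_div ?evx_nz // raddfB /= !rmorphM /= mulNr.
- move=> _ _ [f [g [g0 gB ->]]] [f' [g' [g'0 g'B ->]]].
  exists (f * f'), (g * g'); rewrite mulf_neq0 // coprimepMl gB g'B; split=> //.
  by rewrite mulf_div !rmorphM.
Qed.

End RationalFunctions.

Section KummerBounds.
Variables (K F : fieldType) (iota : {rmorphism K -> F}) (x y : F).
Variables (M : nat) (h : {poly K}).
Variables (N : nat) (Q : 'I_N -> place iota) (gam : 'I_N -> K).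
Hypotheses (M0 : (0 < M)%N) (h0 : h != 0).
Hypothesis hF : is_function_field iota x y ('X^M - h%:P).
Hypothesis (hQ : forall k, place_over x (gam k) (Q k)).
Hypothesis (hgam : forall k, simple_root h (gam k)).
Hypothesis (injQ : injective Q).
Notation ex := (evx iota x).
Let y0 := kummer_neq0 M0 h0 hF.
Let exi := evx_eq0 M0 hF.
Let xk0 := XsubC_neq0 gam M0 hF.

Lemma injective_gam : injective gam.
Proof.
move=> k l e; apply: injQ; apply: (over_uniq M0 h0 hF (hgam l)) => //.
by rewrite -e.
Qed.

(** In lowest terms [A' / B'], a nonconstant [B'] gives a place whose ring contains the localization
    at [B'] but not [A' / B']. Since [B] does not vanish at the [gam k], each [x - gam k] is a unit
    there: the place is outside [Q] and the product cannot cancel the pole. *)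
Lemma finite_part (A B : {poly K}) (l : 'I_N -> int) :
  B != 0 -> (forall k, ~~ root B (gam k)) ->
  (forall P : place iota, ~ range Q P ->
    place_ring P (ex A / ex B * \prod_k (x - iota (gam k)) ^ l k)) ->
  B %| A.
Proof.
move=> B0 Bk hP; have [A' [B' [B'0 cAB e]]] := rational_frac exi A B0.
have eAB : A * B' = A' * B.
  apply/eqP; rewrite -subr_eq0; apply/eqP/exi; rewrite raddfB /= !rmorphM /=; apply/eqP.
  by rewrite subr_eq0 -eqr_div ?e // (evx_nz exi).
have B'B : B' %| B.
  by rewrite -(Gauss_dvdpr B (q := A')) 1?coprimep_sym // -eAB dvdp_mull.
have [sB'|sB'] := eqVneq (size B') 1%N.
  have /size_poly1P [b b0 bE] : size B' == 1%N by apply/eqP.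
  by rewrite -(dvdpZr _ _ b0) -mul_polyC -bE mulrC eAB dvdp_mull.
exfalso; pose O := [set z | exists f g : {poly K},
  [/\ g != 0, coprimep g B' & z = ex f / ex g]].
have [||||P [OP nP]] := @place_avoiding _ _ iota O (ex A' / ex B').
- exact: localization_subring.
- move=> k; exists k%:P, 1; rewrite rmorph1 divr1 evxC oner_neq0.
  by split=> //; apply: coprime1p.
- move=> [f [g [g0 gB' /eqP]]]; rewrite eqr_div ?(evx_nz exi) // -!rmorphM -subr_eq0.
  rewrite -raddfB => /eqP /exi /eqP; rewrite subr_eq0 => /eqP eg.
  move/eqP: sB'; apply; apply/eqP; rewrite -dvdp1.
  rewrite -(Gauss_dvdpr 1 (q := g)) 1?coprimep_sym // mulr1.
  by rewrite -(Gauss_dvdpr g (q := A')) 1?coprimep_sym // eg dvdp_mull.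
- have [->|A'0] := eqVneq A' 0.
    exists 0, 1; rewrite rmorph0 mul0r invr0 mul0r oner_neq0.
    by split=> //; apply: coprime1p.
  by exists B', A'; split=> //; rewrite invf_div.
have uk k : place_unit P (x - iota (gam k)).
  have cX : coprimep ('X - (gam k)%:P) B'.
    rewrite coprimep_sym coprimep_XsubC; apply: contra (Bk k).
    by move/dvdpP: B'B => [c ->]; rewrite rootM => ->; rewrite orbT.
  rewrite -evx_XsubC; split; first by rewrite evx_XsubC.
    apply: OP; exists ('X - (gam k)%:P), 1; rewrite rmorph1 divr1 oner_neq0.
    by split=> //; apply: coprime1p.
  apply: OP; exists 1, ('X - (gam k)%:P); rewrite rmorph1 div1r polyXsubC_eq0.
  by split.
have nQP : ~ range Q P.
  by move=> [k _ QP]; apply: (place_unit_ideal (uk k)); rewrite -QP; apply: hQ.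
apply: nP; rewrite -e; have := hP P nQP; set D := \prod_k _.
have uD : place_unit P D.
  rewrite /D; elim/big_ind: _ => [|a b|k _]; first exact: place_unit1.
    exact: place_unitM.
  exact: place_unitXz.
move=> OD; have [D0 _ ODi] := uD; rewrite -[_ / _](mulfK D0).
exact: place_mul.
Qed.

Lemma infinity_outside (P : place iota) : ~ place_ring P x -> ~ range Q P.
Proof. by move=> nx [k _ QP]; apply: nx; rewrite -QP; apply: over_ring (hQ k). Qed.

Lemma infinity_pole (P : place iota) (A B : {poly K}) (l : 'I_N -> int) :
  ~ place_ring P x -> A != 0 -> B != 0 ->
  has_val P x^-1 (ex A / ex B * \prod_k (x - iota (gam k)) ^ l k)
    ((size B).-1%:Z - (size A).-1%:Z - \sum_k l k).
Proof.
move=> nx A0 B0; have x0 : x != 0.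
  by apply/eqP => x0; apply: nx; rewrite x0; apply: place0.
have t0 : x^-1 != 0 by rewrite invr_eq0.
rewrite -sumrN; apply: (has_valM t0).
  rewrite addrC; apply: (has_valM t0); first exact: infinity_val.
  by rewrite -[X in has_val _ _ _ X]opprK; apply: has_valV; apply: infinity_val.
apply: (has_val_prod t0) => k; rewrite -[X in has_val _ _ _ X]mulN1r; apply: (has_valXz t0).
rewrite -evx_XsubC; have := infinity_val nx (negbT (polyXsubC_eq0 (gam k))).
by rewrite size_XsubC.
Qed.

(** Regularity is read off at one pole of [x], which is not among the [Q k] because [x] is regular
    at those. *)
Lemma degree_bound (A B : {poly K}) (l : 'I_N -> int) : A != 0 -> B != 0 ->
  (forall P : place iota, ~ range Q P ->
    place_ring P (ex A / ex B * \prod_k (x - iota (gam k)) ^ l k)) ->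
  (size A).-1%:Z + \sum_k l k <= (size B).-1%:Z.
Proof.
move=> A0 B0 hP; have [P nx] := infinity_place exi.
have := infinity_pole l nx A0 B0.
have x0 : x != 0 by apply/eqP => x0; apply: nx; rewrite x0; apply: place0.
have t0 : x^-1 != 0 by rewrite invr_eq0.
move=> /(has_val_place_ring t0 (infinity_ideal nx)) /(_ (hP P (infinity_outside nx))).
by rewrite -addrA -opprD subr_ge0.
Qed.

End KummerBounds.

(** * Values attained by a single Kummer component *)

Section SemigroupElements.
Variables (K F : fieldType) (iota : {rmorphism K -> F}) (x y : F).
Variables (M : nat) (h : {poly K}).
Variables (N : nat) (Q : 'I_N -> place iota) (gam : 'I_N -> K).
Hypotheses (M0 : (0 < M)%N) (h0 : h != 0).
Hypothesis hF : is_function_field iota x y ('X^M - h%:P).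
Hypothesis (hQ : forall k, place_over x (gam k) (Q k)).
Hypothesis (hgam : forall k, simple_root h (gam k)).
Hypothesis (injQ : injective Q).
Variables (u : K) (T E : {poly K}) (e m : nat).
Hypothesis hE : h = u%:P * (\prod_k ('X - (gam k)%:P)) * T * E ^+ e.
Hypothesis MeE : M = (e * m)%N.
Hypotheses (sepT : separable_poly T) (sepE : separable_poly E) (cTE : coprimep T E).
Notation ex := (evx iota x).
Let y0 := kummer_neq0 M0 h0 hF.
Let exi := evx_eq0 M0 hF.
Let xk0 := XsubC_neq0 gam M0 hF.
Let T0 : T != 0. Proof. exact: separable_poly_neq0. Qed.
Let E0 : E != 0. Proof. exact: separable_poly_neq0. Qed.
Let e0 : (0 < e)%N. Proof. by move: M0; rewrite MeE muln_gt0 => /andP []. Qed.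
Let m0 : (0 < m)%N. Proof. by move: M0; rewrite MeE muln_gt0 => /andP []. Qed.
Let u0 : u != 0.
Proof. by apply: contra h0 => /eqP u0; rewrite hE u0 !mul0r. Qed.

(** No pole at infinity for [T ^ [i > 0] E ^ c prod_k (x - gam k) ^ (- j k) y ^ -i], stated for its
    [M]-th power so that [y ^ M] becomes [h]. *)
Definition degree_condition (i c : nat) (j : 'I_N -> int) : Prop :=
  M%:Z * (((size T).-1 * (0 < i)%N + (size E).-1 * c)%N%:Z - \sum_k j k)
    <= (i * (size h).-1)%N%:Z.

Lemma evx_h : ex h = iota u * \prod_k (x - iota (gam k)) * ex T * ex E ^+ e.
Proof.
rewrite hE !rmorphM rmorphXn /= evxC rmorph_prod; do 3?congr (_ * _).
by apply: eq_bigr => k _; rewrite /= evx_XsubC.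
Qed.

Lemma size_predX (A : {poly K}) n : A != 0 -> (size (A ^+ n)).-1 = ((size A).-1 * n)%N.
Proof. by move=> A0; rewrite size_exp. Qed.

Lemma size_predM (A B : {poly K}) : A != 0 -> B != 0 ->
  (size (A * B)).-1 = ((size A).-1 + (size B).-1)%N.
Proof.
by move=> A0 B0; rewrite size_mul // (polySpred A0) (polySpred B0) addSn addnS.
Qed.

Lemma prodXz_mul (f : 'I_N -> F) (a b : 'I_N -> int) : (forall k, f k != 0) ->
  \prod_k f k ^ (a k + b k) = (\prod_k f k ^ a k) * (\prod_k f k ^ b k).
Proof. by move=> f0; rewrite -big_split /=; apply: eq_bigr => k _; rewrite expfzDr. Qed.

Lemma prodXz_exp (f : 'I_N -> F) (a : 'I_N -> int) n :
  (\prod_k f k ^ a k) ^+ n = \prod_k f k ^ (a k * n%:Z).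
Proof. by rewrite -prodrXl; apply: eq_bigr => k _; rewrite -exprz_exp. Qed.

Lemma prod_val (l : 'I_N -> int) k :
  has_val (Q k) y (\prod_k' (x - iota (gam k')) ^ l k') (M%:Z * l k).
Proof.
have hk := over_XsubC_val hF (hgam k) (hQ k).
rewrite (bigD1 k) //= -[X in has_val _ _ _ X]addr0; apply: (has_valM y0).
  exact: (has_valXz y0).
apply: has_val_unit; elim/big_ind: _ => [|a b|k' k'k].
- exact: place_unit1.
- exact: place_unitM.
apply: place_unitXz; rewrite -evx_XsubC; apply: (over_evx_unit (hQ k)).
rewrite root_XsubC; apply: contra k'k => /eqP kk'.
by apply/eqP/(injective_gam M0 h0 hF hQ hgam injQ).
Qed.

(** With value 0, [A(x)] and [B(x)] are associates at [Q k], so a root of one would be a root of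
    both, against coprimality. *)
Lemma rational_unit_root (A B : {poly K}) k : B != 0 -> coprimep A B ->
  has_val (Q k) y (ex A / ex B) 0 -> ~~ root A (gam k) /\ ~~ root B (gam k).
Proof.
move=> B0 cAB hv; have exB := evx_nz exi B0.
have [v uv e1] := hv; move: e1; rewrite expr0z mul1r => rE.
have [v0 Ov Ovi] := uv.
have AE : ex A = ex B * v by rewrite -rE mulrCA divff // mulr1.
have BE : ex B = ex A * v^-1 by rewrite AE mulfK.
suff nAB : ~~ root A (gam k) || ~~ root B (gam k).
  split; apply/negP => rt.
    have nB : ~~ root B (gam k) by move: nAB; rewrite rt.
    apply: (place_unit_ideal (over_evx_unit (hQ k) nB)); rewrite BE.
    by apply: place_idealM => //; apply: (over_evx_ideal (hQ k)).
  have nA : ~~ root A (gam k) by move: nAB; rewrite rt orbF.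
  apply: (place_unit_ideal (over_evx_unit (hQ k) nA)); rewrite AE.
  by apply: place_idealM => //; apply: (over_evx_ideal (hQ k)).
rewrite -negb_and; apply/negP => /andP [rA rB].
by have := coprimep_root cAB rA; rewrite (eqP rB) eqxx.
Qed.

Lemma root_TE k : ~~ root T (gam k) /\ ~~ root E (gam k).
Proof.
have [h1 h1E nr] := hgam k.
have hh : h1 = u%:P * (\prod_(k' | k' != k) ('X - (gam k')%:P)) * T * E ^+ e.
  apply: (mulIf (negbT (polyXsubC_eq0 (gam k)))); rewrite -h1E hE (bigD1 k) //=.
  by ring.
move: nr; rewrite hh !rootM !negb_or => /andP [/andP [_ nT] nE]; split=> //.
by apply: contra nE => rE; rewrite -(prednK e0) exprS rootM rE.
Qed.

(** Once its zeros and poles at the [gam k] are removed, [r] becomes a fraction [A / B] prime to all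
    of them. Regularity of the [M]-th power at finite places makes [B] constant and [A] divisible by
    [T ^ [i > 0] E ^ c]; this lower bound on [deg A] meets regularity at infinity. *)
Lemma component_bound (i c : nat) (j : 'I_N -> int) (r : F) :
  rational iota x r -> r != 0 -> regular_outside Q (r * y ^- i) ->
  (forall k, has_val (Q k) y (r * y ^- i) (- (M%:Z * j k + i%:Z))) ->
  (c * m < i + m)%N -> degree_condition i c j.
Proof.
move=> rr r0 Rw hw cm.
pose D l := \prod_k (x - iota (gam k)) ^ (l k).
have Dr l : rational iota x (D l).
  apply: (rational_prod exi) => k; apply: (rationalXz exi).
  by rewrite -evx_XsubC; apply: rational_evx.
have D0 l : D l != 0 by apply/prodf_neq0 => k _; apply: expfz_neq0.
have [A [B [B0 cAB rE]]] := rationalM exi rr (Dr j).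
have exB := evx_nz exi B0.
have A0 : A != 0.
  by apply: contra (mulf_neq0 r0 (D0 j)) => /eqP A0; rewrite rE A0 rmorph0 mul0r.
have nroot k : ~~ root A (gam k) /\ ~~ root B (gam k).
  apply: rational_unit_root => //; rewrite -rE.
  have -> : r * D j = r * y ^- i * D j * y ^+ i.
    by rewrite -mulrA [_ * y ^+ i]mulrC !mulrA mulfVK ?expf_neq0.
  have -> : 0 = - (M%:Z * j k + i%:Z) + M%:Z * j k + i%:Z by ring.
  apply: (has_valM y0); first by apply: (has_valM y0); [apply: hw|apply: prod_val].
  by have := has_valX y0 i (has_val_base (Q k) y); rewrite mul1r.
have yM : y ^+ i ^+ M = ex h ^+ i by rewrite exprAC (kummer_eq hF).
have wM : (r * y ^- i) ^+ M =
    ex (A ^+ M) / (ex (B ^+ M) * ex h ^+ i) * D (fun k => - (j k * M%:Z)).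
  have -> : r = ex A / ex B * D (fun k => - j k).
    rewrite -rE -mulrA -prodXz_mul //.
    by rewrite big1 ?mulr1 // => k _; rewrite subrr expr0z.
  rewrite exprMn exprVn yM exprMn prodXz_exp expr_div_n !rmorphXn invfM.
  under [X in _ = _ * X]eq_bigr => k _ do rewrite -mulNr.
  by rewrite /D; ring.
have Pw (P : place iota) : ~ range Q P -> place_ring P ((r * y ^- i) ^+ M).
  by move=> nP; apply: placeX; apply: Rw.
have exE := evx_nz exi E0; have exT := evx_nz exi T0; have exh := evx_nz exi h0.
have ui : iota u != 0 by rewrite fmorph_eq0.
have BTE : B ^+ M * (T ^+ i * E ^+ (e * i)) %| A ^+ M.
  (* The exponent [-i] absorbs the factors [x - gam k] of [h ^ -i], so that the remaining
     denominator does not vanish at the [gam k]. *)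
  apply: (finite_part M0 hF hQ (l := fun k => - (j k * M%:Z) + - i%:Z)).
  - by rewrite !mulf_neq0 ?expf_neq0.
  - have nX (p : {poly K}) (z : K) n : ~~ root p z -> ~~ root (p ^+ n) z.
      by rewrite /root horner_exp => pz; rewrite expf_neq0.
    move=> k; have [nT nE] := root_TE k.
    by rewrite !rootM !negb_or !nX //; case: (nroot k).
  move=> P nP; have := place_mul (place_const P (u ^+ i)) (Pw P nP).
  suff -> : iota (u ^+ i) * (r * y ^- i) ^+ M =
    ex (A ^+ M) / ex (B ^+ M * (T ^+ i * E ^+ (e * i))) *
      \prod_k (x - iota (gam k)) ^ (- (j k * M%:Z) + - i%:Z) by [].
  rewrite wM prodXz_mul // -/(D _) evx_h.
  have -> : \prod_k (x - iota (gam k)) ^ (- i%:Z) = (\prod_k (x - iota (gam k))) ^- i.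
    by rewrite -exprVn -prodfV -prodrXl; apply: eq_bigr => k _; rewrite exprVn exprnN.
  rewrite !(rmorphM (evx iota x)) !(rmorphXn (evx iota x)) (rmorphXn iota) /= !exprMn -exprM.
  have X0 : \prod_k (x - iota (gam k)) != 0 by apply/prodf_neq0.
  by field; rewrite ?expf_neq0.
have BA : B ^+ M %| A ^+ M by apply: dvdp_trans BTE; apply: dvdp_mulr.
have sB : size B = 1%N.
  apply/eqP; rewrite -dvdp1 -(Gauss_dvdpr 1 (q := A)) 1?coprimep_sym // mulr1.
  by rewrite -(dvdp_pexp2r _ _ M0).
have TA : T ^+ (0 < i)%N %| A.
  case: (posnP i) => [_|i0]; first by rewrite expr0 dvd1p.
  rewrite expr1; apply: (separable_dvdp_exp (n := M) sepT); apply: dvdp_trans BTE.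
  by apply: dvdp_mull; apply: dvdp_mulr; rewrite -(prednK i0) exprS dvdp_mulr.
have EA : E ^+ c %| A.
  (* As [M = e m], divisibility of [A ^ M] by [E ^ (e i)] is the [e]-th power of divisibility of
     [A ^ m] by [E ^ i]. *)
  apply: (separable_exp_dvdp_exp m0 sepE cm); rewrite -(dvdp_pexp2r _ _ e0) -!exprM.
  rewrite [(i * e)%N]mulnC [(m * e)%N]mulnC -MeE; apply: dvdp_trans BTE.
  by apply: dvdp_mull; apply: dvdp_mull.
have TEA : T ^+ (0 < i)%N * E ^+ c %| A.
  by rewrite Gauss_dvdp ?TA // coprimep_expl // coprimep_expr.
have dA : ((size T).-1 * (0 < i)%N + (size E).-1 * c <= (size A).-1)%N.
  have := dvdp_leq A0 TEA.
  rewrite -(size_predX _ T0) -(size_predX _ E0) -size_predM ?expf_neq0 //.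
  by move=> le; rewrite -!subn1 leq_sub2r.
have := degree_bound M0 hF hQ (A := A ^+ M) (B := B ^+ M * h ^+ i)
  (l := fun k => - (j k * M%:Z)).
rewrite !mulf_neq0 ?expf_neq0 // => /(_ isT isT) H.
have {H} : (size (A ^+ M)).-1%:Z + \sum_k - (j k * M%:Z) <= (size (B ^+ M * h ^+ i)).-1.
  apply: H => P /Pw; rewrite wM (rmorphM (evx iota x) (B ^+ M)) (rmorphXn (evx iota x) i h).
  exact.
rewrite size_predM ?expf_neq0 // !size_predX // sB sumrN -mulr_suml /degree_condition.
move: dA; set S := \sum_k j k; set X := ((size T).-1 * _ + _)%N; set Y := (size A).-1.
by clearbody S X Y; move: M0; clear; nia.
Qed.

(** The converse of [component_bound]: the two conditions on [c] together force [c = ceil(i / m)],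
    and the witness is the function described by [degree_condition]. *)
Lemma semigroup_element (i c : nat) (j : 'I_N -> int) :
  (i < M)%N -> (i <= m * c)%N -> degree_condition i c j ->
  exists w, [/\ regular_outside Q w, w != 0 &
    forall k, has_val (Q k) y w (- (M%:Z * j k + i%:Z))].
Proof.
move=> iM imc dc.
pose D l := \prod_k (x - iota (gam k)) ^ (l k).
have D0 l : D l != 0 by apply/prodf_neq0 => k _; apply: expfz_neq0.
pose G := T ^+ (0 < i)%N * E ^+ c.
have G0 : G != 0 by rewrite mulf_neq0 ?expf_neq0.
have exE := evx_nz exi E0; have exT := evx_nz exi T0; have exh := evx_nz exi h0.
have exG := evx_nz exi G0.
have ui : iota u != 0 by rewrite fmorph_eq0.
exists (ex G * D (fun k => - j k) * y ^- i); split.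
- have yM : y ^+ i ^+ M = ex h ^+ i by rewrite exprAC (kummer_eq hF).
  set w := _ * _; have wM : w ^+ M = ex (G ^+ M) / ex (h ^+ i) * D (fun k => - (j k * M%:Z)).
    rewrite /w (rmorphXn (evx iota x) M G) (rmorphXn (evx iota x) i h).
    rewrite /=; move: (ex G) => g; rewrite !exprMn exprVn yM prodXz_exp mulrAC.
    by congr (_ * _); apply: eq_bigr => k _; rewrite mulNr.
  move=> P nP; apply: (place_root M0); rewrite wM.
  have [Ox|nx] := pselect (place_ring P x).
    have uX : place_unit P (\prod_k (x - iota (gam k))).
      elim/big_ind: _ => [|a b|k _]; [exact: place_unit1|exact: place_unitM|].
      exact: (outside_unit M0 h0 hF hQ hgam).
    have OD l : place_ring P (D l).
      apply: place_prod => k _.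
      by have [] := place_unitXz (l k) (outside_unit M0 h0 hF hQ hgam k nP Ox).
    apply: place_mul => //.
    (* At places where [x] is regular, [G ^ M] has to absorb the factor [T ^ i E ^ (e i)] of
       [h ^ i]; this uses [i < M] for [T] and [i <= m c] for [E]. *)
    have -> : G ^+ M = T ^+ i * E ^+ (e * i) * (T ^+ ((0 < i) * M - i) * E ^+ (c * M - e * i)).
      have iT : (i <= (0 < i) * M)%N by case: (i) iM => // i' iM'; rewrite mul1n ltnW.
      have iE : (e * i <= c * M)%N by rewrite MeE mulnCA leq_mul2l mulnC imc orbT.
      by rewrite /G exprMn -!exprM mulrACA -!exprD !subnKC.
    have -> : ex (T ^+ i * E ^+ (e * i) * (T ^+ ((0 < i) * M - i) * E ^+ (c * M - e * i))) /
        ex (h ^+ i) = ex (T ^+ ((0 < i) * M - i) * E ^+ (c * M - e * i)) *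
          (iota u^-1 * (\prod_k (x - iota (gam k)))^-1) ^+ i.
      rewrite (rmorphXn (evx iota x) i h) (rmorphM (evx iota x) (T ^+ i * _)) /= evx_h.
      move: (ex (T ^+ (_ - _) * _)) => Z.
      rewrite (rmorphM (evx iota x)) !(rmorphXn (evx iota x)) fmorphV /= !exprMn -exprM !exprVn.
      have [X0 _ _] := uX.
      by field; rewrite ?expf_neq0.
    apply: place_mul; first exact: evx_ring.
    apply: placeX; apply: place_mul; first exact: place_const.
    by case: uX.
  have x0 : x != 0 by apply/eqP => x0; apply: nx; rewrite x0; apply: place0.
  have t0 : x^-1 != 0 by rewrite invr_eq0.
  have hv := infinity_pole gam (fun k => - (j k * M%:Z)) nx
    (expf_neq0 M G0) (expf_neq0 i h0).
  apply: (has_val_ring (infinity_ideal nx) hv).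
  rewrite !size_predX // size_predM ?expf_neq0 // !size_predX // sumrN -mulr_suml.
  move: dc; rewrite /degree_condition.
  set S := \sum_k j k; set X := ((size T).-1 * _ + _)%N.
  by clearbody S X; move: M0; clear; nia.
- by rewrite !mulf_neq0 ?invr_eq0 ?expf_neq0.
move=> k; have -> : - (M%:Z * j k + i%:Z) = 0 + M%:Z * (- j k) + - i%:Z by ring.
apply: (has_valM y0); last first.
  by apply: has_valV; have := has_valX y0 i (has_val_base (Q k) y); rewrite mul1r.
apply: (has_valM y0); last exact: prod_val.
apply: has_val_unit; apply: (over_evx_unit (hQ k)); have [nT nE] := root_TE k.
rewrite /root hornerM !horner_exp mulf_neq0 //; exact: expf_neq0.
Qed.

End SemigroupElements.

(** * Maximal elements *)

Section MaximalElements.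
Variables (K F : fieldType) (iota : {rmorphism K -> F}) (N M : nat).
Variables (Q : 'I_N -> place iota) (B : nat -> int).
Hypotheses (M0 : (0 < M)%N) (N2 : (2 <= N)%N).
Notation W := (weierstrass_semigroup Q).

Definition lift_tuple (i : nat) (j : 'I_N -> int) : 'I_N -> int :=
  fun k => M%:Z * j k + i%:Z.

Hypothesis W_lift : forall i j, (i < M)%N -> B i <= \sum_k j k -> W (lift_tuple i j).
(* Every element of the semigroup is a pointwise maximum of elements [lift_tuple i j]
   of pairwise distinct residues [i]. *)
Hypothesis W_component : forall alpha k, W alpha -> exists i j,
  [/\ (i < M)%N, B i <= \sum_l j l, forall l, lift_tuple i j l <= alpha l,
      alpha k = lift_tuple i j k &
      forall l (a : int), alpha l = M%:Z * a + i%:Z -> j l = a].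

Lemma lift_tuple_inj i i' (a b : int) : (i < M)%N -> (i' < M)%N ->
  M%:Z * a + i%:Z = M%:Z * b + i'%:Z -> i = i' /\ a = b.
Proof.
move=> iM i'M e; have ii' : i = i'.
  apply: (eq_mulB_lt (k := - a) (l := - b) iM i'M).
  by rewrite !mulrN -!opprD e.
split=> //; move: e; rewrite ii' => /addIr /mulfI; apply.
by rewrite eqz_nat -lt0n.
Qed.

Lemma lift_tuple_lt i (a b : int) : M%:Z * a + i%:Z < M%:Z * b + i%:Z -> a <= b - 1.
Proof. by rewrite ltrD2r ltr_pM2l ?ltz_nat // -ltzD1 subrK. Qed.

Lemma lift_tuple_le i (a b : int) : M%:Z * a + i%:Z <= M%:Z * b + i%:Z -> a <= b.
Proof. by rewrite lerD2r ler_pM2l ?ltz_nat. Qed.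

Lemma sum_sub_notin (J : {set 'I_N}) (j : 'I_N -> int) :
  \sum_k (j k - (k \notin J)%:Z) = \sum_k j k - (N - #|J|)%N%:Z.
Proof.
have -> : (N - #|J| = #|~: J|)%N by rewrite [RHS]cardsCs finset.setCK card_ord.
rewrite sumrB; congr (_ - _); rewrite -sum1_card -[RHS]natz natr_sum.
rewrite [in RHS]big_mkcond /=; apply: eq_bigr => k _.
by rewrite inE; case: (k \in J).
Qed.

(** The component that attains [beta] at [k] has residue [i], so it agrees with [j] on all of [J];
    at each index outside [J] it is smaller by at least 1. *)
Lemma nabla_on_component (J : {set 'I_N}) i j beta k : (i < M)%N ->
  nabla_on Q J (lift_tuple i j) beta -> k \in J ->
  B i <= \sum_l j l - (N - #|J|)%N%:Z.
Proof.
move=> iM [Wb bJ bnJ] kJ; have [i' [j' [i'M sj' le' ek eq']]] := W_component k Wb.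
have [ii' _] : i = i' /\ j k = j' k by apply: lift_tuple_inj => //; rewrite -[LHS]bJ.
rewrite -{i'}ii' in i'M sj' le' ek eq'.
rewrite -sum_sub_notin; apply: le_trans sj' _; apply: ler_sum => l _.
have [lJ|lJ] := boolP (l \in J); last first.
  by apply: lift_tuple_lt; apply: le_lt_trans (le' l) (bnJ _ lJ).
by rewrite subr0 (eq' l (j l)) // bJ.
Qed.

(** The converse of [nabla_on_component]: lowering [j] by exactly 1 at each index outside [J] costs
    the least in the sum. *)
Lemma nabla_on_lift (J : {set 'I_N}) i j : (i < M)%N ->
  B i <= \sum_l j l - (N - #|J|)%N%:Z -> nabla_on Q J (lift_tuple i j) !=set0.
Proof.
move=> iM; rewrite -sum_sub_notin => hB.
exists (lift_tuple i (fun k => j k - (k \notin J)%:Z)); split.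
- exact: W_lift.
- by move=> l lJ; rewrite /lift_tuple lJ subr0.
- move=> l lJ; rewrite /lift_tuple lJ ltrD2r ltr_pM2l ?ltz_nat //.
  by rewrite ltrBlDr ltrDl.
Qed.

Lemma set1_proper (k : 'I_N) : [set k]%SET \proper [set: 'I_N]%SET.
Proof. by rewrite properEcard finset.subsetT cards1 cardsT card_ord. Qed.

Lemma maximal_nabla_on1 alpha k : maximal Q alpha -> nabla_on Q [set k]%SET alpha = set0.
Proof.
move=> [_ n0]; apply/seteqP; split=> // beta hb.
by rewrite -n0; exists k.
Qed.

Lemma maximalP alpha : W alpha -> (forall k, nabla_on Q [set k]%SET alpha = set0) ->
  maximal Q alpha.
Proof.
by move=> Wa h; split=> //; apply/seteqP; split=> // beta [k _]; rewrite h.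
Qed.

Lemma absolute_maximal_nabla_on alpha (J : {set 'I_N}) : absolute_maximal Q alpha ->
  J \proper [set: 'I_N]%SET -> J != finset.set0 -> nabla_on Q J alpha = set0.
Proof.
move=> [maxa absa] pJ; rewrite -card_gt0 => J0.
have [J2|J1] := leqP 2 #|J|; first exact: absa.
have /cards1P [k ->] : #|J| == 1%N by rewrite eqn_leq J0 -ltnS J1.
exact: maximal_nabla_on1.
Qed.

Lemma absolute_maximalE alpha : absolute_maximal Q alpha <->
  exists i j, [/\ (i < M)%N, \sum_k j k = B i & alpha = lift_tuple i j].
Proof.
pose k0 : 'I_N := Ordinal (ltnW N2).
split=> [absa|[i [j [iM sj ->]]]].
  have [Wa _] := absa.1; have [i [j [iM sj le ek _]]] := W_component k0 Wa.
  have aE : alpha = lift_tuple i j.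
    (* On the set [J] where the component meets [alpha], it is a witness for [nabla_on]; absolute
       maximality leaves only the case where [J] is everything. *)
    pose J := [set l | lift_tuple i j l == alpha l]%SET.
    have k0J : k0 \in J by rewrite inE ek.
    have [JT|JT] := boolP (J \proper [set: 'I_N]%SET); last first.
      apply/funext => l; have : l \in J.
        by move: JT; rewrite properT negbK => /eqP ->; rewrite inE.
      by rewrite inE => /eqP ->.
    have : nabla_on Q J alpha (lift_tuple i j).
      split; [exact: W_lift|by move=> l; rewrite inE => /eqP|].
      by move=> l; rewrite inE => ne; rewrite lt_neqAle ne le.
    rewrite absolute_maximal_nabla_on //.
    by apply/set0Pn; exists k0.
  exists i, j; split=> //; apply/eqP; rewrite eq_le sj andbT leNgt; apply/negP => ltB.
  have card_k0 : #|~: [set k0]%SET| = N.-1.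
    by rewrite cardsC1 card_ord.
  (* Only one coordinate has to drop here, so an excess of a single unit over [B i] already produces
     an element. *)
  have : nabla_on Q (~: [set k0])%SET (lift_tuple i j) !=set0.
    apply: nabla_on_lift => //; rewrite card_k0.
    have -> : (N - N.-1 = 1)%N by move: N2; clear; lia.
    by rewrite lerBrDr lezD1.
  rewrite -aE absolute_maximal_nabla_on ?set0P ?eqxx //.
  - by move=> [].
  - by rewrite properEcard finset.subsetT card_k0 cardsT card_ord; move: N2; clear; lia.
  - by rewrite -card_gt0 card_k0; move: N2; clear; lia.
have empty (J : {set 'I_N}) : J \proper [set: 'I_N]%SET -> J != finset.set0 ->
    nabla_on Q J (lift_tuple i j) = set0.
  move=> pJ /set0Pn [k kJ]; apply/seteqP; split=> // beta hb.
  have := nabla_on_component iM hb kJ; rewrite sj.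
  have := proper_card pJ; rewrite cardsT card_ord; clear; lia.
have Wa : W (lift_tuple i j) by apply: W_lift => //; rewrite sj.
split; first apply: maximalP => // k.
  by apply: empty (set1_proper k) _; apply/set0Pn; exists k; rewrite inE.
by move=> J pJ J2; apply: empty => //; rewrite -card_gt0; apply: leq_trans J2.
Qed.

Lemma relative_maximalE alpha : relative_maximal Q alpha <->
  exists i j, [/\ (i < M)%N, \sum_k j k = B i + (N%:Z - 2) & alpha = lift_tuple i j].
Proof.
pose k0 : 'I_N := Ordinal (ltnW N2); pose k1 : 'I_N := Ordinal N2.
split=> [[maxa rela]|[i [j [iM sj ->]]]]; last first.
  have Wa : W (lift_tuple i j) by apply: W_lift => //; rewrite sj; move: N2; clear; lia.
  split; first apply: maximalP => // k.
    apply/seteqP; split=> // beta hb.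
    have := nabla_on_component iM hb (set11 k); rewrite sj cards1; move: N2; clear; lia.
  move=> J /proper_card; rewrite cardsT card_ord => JN J2.
  by apply: nabla_on_lift => //; rewrite sj; move: JN J2; clear; lia.
have Wa := maxa.1.
(* Every residue is compared with that at [k0]. The component through [k0] of an element of
   [nabla_on] for the pair must reach [alpha] at [l] too, since otherwise it would lie in the empty
   [nabla_on] of [k0]. *)
have pair l : l != k0 -> exists i (j : 'I_N -> int), [/\ (i < M)%N, B i <= \sum_m j m,
    alpha k0 = lift_tuple i j k0, alpha l = lift_tuple i j l &
    forall m, m != k0 -> m != l -> lift_tuple i j m < alpha m].
  move=> lk0.
  have [beta [Wb bk0 bl bm]] : exists beta, [/\ W beta, beta k0 = alpha k0,
      beta l = alpha l & forall m, m != k0 -> m != l -> beta m < alpha m].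
    have cJ : #|[set k0; l]%SET| = 2 by rewrite cards2 eq_sym lk0.
    have [N3|N3] := ltnP 2 N.
      have [] := rela [set k0; l]%SET; rewrite ?cJ //.
        by rewrite properEcard finset.subsetT cJ cardsT card_ord.
      move=> beta [Wb be bn]; exists beta; split=> //.
      - by apply: be; rewrite !inE eqxx.
      - by apply: be; rewrite !inE eqxx orbT.
      - by move=> m mk0 ml; apply: bn; rewrite !inE negb_or mk0.
    (* For [N = 2] the pair is the whole index set and not a proper subset; [alpha] itself then
       serves as [beta]. *)
    exists alpha; split=> // m mk0 ml; exfalso.
    have JT : [set k0; l]%SET = [set: 'I_N]%SET.
      by apply/eqP; rewrite eqEcard finset.subsetT cJ cardsT card_ord.
    have : m \in [set k0; l]%SET by rewrite JT inE.
    by rewrite !inE (negbTE mk0) (negbTE ml).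
  have [i [j [iM sj le ek _]]] := W_component k0 Wb.
  exists i, j; split=> //; first by rewrite -bk0.
  - apply/eqP; apply/negPn/negP => ne.
    suff : nabla_on Q [set k0]%SET alpha (lift_tuple i j) by rewrite maximal_nabla_on1.
    split; first exact: W_lift.
      by move=> m /set1P ->; rewrite -ek.
    move=> m; rewrite inE => mk0; have [->|ml] := eqVneq m l.
      by rewrite lt_neqAle eq_sym ne -bl le.
    by apply: le_lt_trans (le m) (bm _ mk0 ml).
  - by move=> m mk0 ml; apply: le_lt_trans (le m) (bm _ mk0 ml).
have [i [j [iM sj a0 a1 lt]]] := pair k1 isT.
have /choice [a aE] : forall l, exists a : int, alpha l = M%:Z * a + i%:Z.
  move=> l; have [->|lk0] := eqVneq l k0; first by exists (j k0).
  have [i' [j' [i'M _ a0' al _]]] := pair l lk0.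
  have [-> _] : i = i' /\ j k0 = j' k0 by apply: lift_tuple_inj => //; apply: etrans (esym a0) a0'.
  by exists (j' l).
have alphaE : alpha = lift_tuple i a by apply/funext => l; apply: aE.
(* Upper bound: emptiness for the single index [k0], where [N - 1] coordinates would drop. Lower
   bound: the component for the pair [k0], [k1], which loses at least 1 at each of the other [N - 2]
   indices. *)
exists i, a; split=> //; apply/eqP; rewrite eq_le; apply/andP; split.
  rewrite leNgt; apply/negP => ltB.
  have : nabla_on Q [set k0]%SET alpha !=set0.
    rewrite alphaE; apply: nabla_on_lift => //; rewrite cards1.
    by move: ltB N2; set S := \sum_k a k; clearbody S; clear; lia.
  by rewrite maximal_nabla_on1 // => -[].
have le : \sum_m j m <= \sum_m (a m - (m \notin [set k0; k1]%SET)%:Z).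
  apply: ler_sum => l _; rewrite !inE negb_or.
  have [->|lk0] := eqVneq l k0.
    by rewrite subr0; apply: (@lift_tuple_le i); rewrite -aE a0.
  have [->|lk1] := eqVneq l k1.
    by rewrite subr0; apply: (@lift_tuple_le i); rewrite -aE a1.
  by apply: (@lift_tuple_lt i); rewrite -aE; apply: lt.
have := le_trans sj le; rewrite sum_sub_notin cards2.
by move: N2; set S := \sum_k a k; clearbody S; clear; lia.
Qed.

End MaximalElements.

(** * From Kummer components to the generalized semigroup *)

Section KummerMaximal.
Variables (K F : fieldType) (iota : {rmorphism K -> F}) (x y : F).
Variables (M : nat) (h : {poly K}) (zeta : K).
Variables (N : nat) (Q : 'I_N -> place iota) (gam : 'I_N -> K).
Hypotheses (M0 : (0 < M)%N) (h0 : h != 0).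
Hypothesis hF : is_function_field iota x y ('X^M - h%:P).
Hypotheses (hM : (M%:R : K) != 0) (hzeta : M.-primitive_root zeta).
Hypothesis (hQ : forall k, place_over x (gam k) (Q k)).
Hypothesis (hgam : forall k, simple_root h (gam k)).
Hypothesis (injQ : injective Q).
Variables (u : K) (T E : {poly K}) (e m : nat).
Hypothesis hE : h = u%:P * (\prod_k ('X - (gam k)%:P)) * T * E ^+ e.
Hypothesis MeE : M = (e * m)%N.
Hypotheses (sepT : separable_poly T) (sepE : separable_poly E) (cTE : coprimep T E).
Variables (B : nat -> int) (c : nat -> nat).
Hypotheses (cub : forall i, (i <= m * c i)%N) (clb : forall i, (c i * m < i + m)%N).
Hypothesis BE : forall i j, (i < M)%N ->
  degree_condition M h T E i (c i) j <-> B i <= \sum_(k < N) j k.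
Let y0 := kummer_neq0 M0 h0 hF.

Lemma kummer_semigroup_lift i (j : 'I_N -> int) :
  (i < M)%N -> B i <= \sum_k j k -> weierstrass_semigroup Q (lift_tuple M i j).
Proof.
move=> iM /(BE j iM) dc.
have [w [Rw w0 hw]] :=
  semigroup_element M0 h0 hF hQ hgam injQ hE MeE sepT sepE iM (cub i) dc.
exists w; split=> //; apply/funext => k.
by rewrite (over_nu M0 h0 hF (hgam k) (hQ k) (hw k)) opprK.
Qed.

(** The component is the one of least value at [Q k]. The residue of a value modulo [M] names the
    dominating index, so a coordinate of [alpha] congruent to [i] is attained by that same
    component. *)
Lemma kummer_semigroup_component alpha k : weierstrass_semigroup Q alpha ->
  exists i j, [/\ (i < M)%N, B i <= \sum_l j l, forall l, lift_tuple M i j l <= alpha l,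
      alpha k = lift_tuple M i j k &
      forall l (a : int), alpha l = M%:Z * a + i%:Z -> j l = a].
Proof.
move=> [z [Rz z0 ->]]; have [r [g [r0 zE]]] := kummer_decomp M0 h0 hF z.
have /choice [v hv] : forall l : 'I_N, exists v : ('I_M -> int) * 'I_M, [/\ g v.2 != 0,
    forall i, g i != 0 -> M%:Z * v.1 v.2 - v.2%:Z <= M%:Z * v.1 i - i%:Z,
    nu (Q l) z = M%:Z * v.1 v.2 - v.2%:Z &
    forall i, g i != 0 ->
      has_val (Q l) y (evx iota x (g i) / evx iota x r * y ^- i) (M%:Z * v.1 i - i%:Z)].
  move=> l; have [s [i0 [gi0 le hs]]] := over_val_decomp M0 h0 hF (hgam l) r0 zE z0.
  have [hz hi] := hs _ (hQ l).
  by exists (s, i0); split=> //=; apply: (over_nu M0 h0 hF (hgam l) (hQ l)).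
pose i := (v k).2; pose j l := - (v l).1 i.
have gi : g i != 0 by case: (hv k).
have liftE l : lift_tuple M i j l = - (M%:Z * (v l).1 i - i%:Z).
  by rewrite /lift_tuple /j mulrN opprB addrC.
exists i, j; split=> //.
- apply/BE => //.
  apply: (component_bound M0 h0 hF hQ hgam injQ hE MeE sepT sepE cTE
    (r := evx iota x (g i) / evx iota x r)) => //.
  + exact: (rational_frac (evx_eq0 M0 hF)).
  + by rewrite mulf_neq0 ?invr_eq0 ?(evx_neq0 M0 hF).
  + exact: (regular_component M0 h0 hF hM hzeta hQ hgam r0 zE Rz).
  + move=> l; have := liftE l; rewrite /lift_tuple => ->; rewrite opprK.
    by case: (hv l) => _ _ _; apply.
- by move=> l; rewrite liftE; case: (hv l) => _ le -> _; rewrite lerN2; apply: le.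
- by rewrite liftE; case: (hv k) => _ _ -> _.
move=> l a; case: (hv l) => _ _ -> _ ea.
have [vi va] : (v l).2 = i :> nat /\ - (v l).1 (v l).2 = a.
  by apply: (lift_tuple_inj M0) => //; rewrite -ea mulrN opprB addrC.
by rewrite /j -va; congr (- (v l).1 _); apply: val_inj.
Qed.

End KummerMaximal.

(** * Arithmetic of the two curves *)

Lemma dvdn_succ_exp_odd q n : odd n -> (q.+1 %| q ^ n + 1)%N.
Proof.
move=> on; rewrite -(odd_double_half n) on -muln2; elim: n./2 => [|k IH].
  by rewrite mul0n expn1 addn1.
(* Adding the multiple [(q + 1) q ^ n] turns [q ^ (n + 2) + 1] into [(q ^ (n + 2) + q ^ (n + 1)) +
   (q ^ n + 1)], which avoids subtraction in [nat]. *)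
have h : (q ^ (true + k.+1 * 2) + 1 + q.+1 * (q ^ (true + k * 2)) * 1 =
  q ^ (true + k.+1 * 2) + q ^ (true + k * 2) * q + (q ^ (true + k * 2) + 1))%N.
  rewrite /=; lia.
have : (q.+1 %| q ^ (true + k.+1 * 2) + q ^ (true + k * 2) * q + (q ^ (true + k * 2) + 1))%N.
  rewrite dvdn_add //.
  have -> : (q ^ (true + k.+1 * 2) = q ^ (true + k * 2) * q * q)%N.
    by rewrite -!expnSr; congr (_ ^ _)%N; lia.
  by rewrite -mulnSr dvdn_mull.
by rewrite -h dvdn_addl // muln1 dvdn_mulr.
Qed.

Lemma finField_prim_root (K : finFieldType) M : (M %| #|K|.-1)%N ->
  exists zeta : K, M.-primitive_root zeta.
Proof.
move=> MK; have K1 : (0 < #|K|.-1)%N by rewrite -ltnS prednK ?finNzRing_gt1 // ltnW ?finNzRing_gt1.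
pose rs := [seq z <- enum K | z != 0].
have srs : size rs = #|K|.-1.
  rewrite size_filter -sum1_count big_enum_cond /= sum1_card.
  by rewrite -(cardC1 (0 : K)); apply: eq_card => z; rewrite !inE.
have rsU : all (#|K|.-1).-unity_root rs.
  apply/allP => z; rewrite mem_filter => /andP [z0 _]; apply/unity_rootP.
  apply: (mulIf z0); rewrite -exprSr mul1r prednK ?expf_card //.
  by rewrite ltnW // finNzRing_gt1.
have := has_prim_root K1 rsU (filter_uniq _ (enum_uniq _)).
rewrite srs leqnn => /(_ isT) /hasP [z _ pz].
by exists (z ^+ (#|K|.-1 %/ M)); apply: dvdn_prim_root.
Qed.

Section BasePoly.
Variables (K : fieldType) (p a b : nat) (C : curve).
Hypotheses (pK : p \in [pchar K]) (b0 : (1 <= b)%N) (hba : (b %| a)%N) (hlt : (b < a)%N).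
Let q := (p ^ a)%N.
Let d := curve_d C p b.
Notation t := (base_poly K C p a b).

Let p_prime : prime p. Proof. exact: pcharf_prime pK. Qed.
Let p_gt1 : (1 < p)%N. Proof. exact: prime_gt1. Qed.

Lemma expp_eq0 n : (0 < n)%N -> (p ^ n)%:R = 0 :> K.
Proof. by case: n => // n _; rewrite natrX (pcharf0 pK) expr0n. Qed.

(** In characteristic [p] only the linear term survives; separability of the base polynomial
    follows. *)
Lemma deriv_base_poly : t^`() = 1.
Proof.
have a0 : (0 < a)%N by apply: leq_trans hlt.
have derivXp n : (0 < n)%N -> ('X^(p ^ n) : {poly K})^`() = 0.
  by move=> n0; rewrite derivXn -mulr_natr -polyC_natr expp_eq0 ?mulr0.
case: C; rewrite /=; last by rewrite derivD derivX derivXp // add0r.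
have r0 : (0 < a %/ b)%N by rewrite divn_gt0 // ltnW.
rewrite raddf_sum /= -(prednK r0) big_ord_recl /= mul0n expn0 derivX big1 ?addr0 // => i _.
by rewrite derivXp // muln_gt0 b0.
Qed.

Lemma curve_d_mul : ((q %/ d) * d)%N = q /\ (0 < d)%N.
Proof.
rewrite /d /q; case: C => /=; last by rewrite divn1 muln1.
have pb : (0 < p ^ b)%N by rewrite expn_gt0 ltnW.
by split=> //; rewrite divnK // dvdn_exp2l // ltnW.
Qed.

Lemma size_base_poly : size t = (q %/ d).+1.
Proof.
rewrite /d /q; case: C => /=; last first.
  rewrite divn1 size_polyDl size_polyXn // size_polyX ltnS.
  by rewrite -[X in (X < _)%N](expn0 p) ltn_exp2l // (leq_trans _ hlt).
have /dvdnP [r aE] := hba; move: hlt; rewrite aE mulnK // => hr.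
have : (1 < r)%N by move: hr b0; clear; nia.
case: r {aE hr} => [//|r] r1; rewrite mulSn expnD mulKn ?expn_gt0 ?(ltnW p_gt1) //.
rewrite big_ord_recr /= addrC size_polyDl size_polyXn // ltnS.
apply: leq_trans (size_sum _ _ _) _; apply/bigmax_leqP => i _.
by rewrite size_polyXn ltn_exp2l // ltn_pmul2r.
Qed.

End BasePoly.

Section Ceiling.
Local Open Scope nat_scope.
Definition ceil_div (m i : nat) : nat := (i + m.-1) %/ m.
Lemma ceil_div_ub m i : 0 < m -> i <= m * ceil_div m i.
Proof.
move=> m0; rewrite /ceil_div; have := ltn_ceil (i + m.-1) m0; rewrite mulSn; lia.
Qed.
Lemma ceil_div_lb m i : 0 < m -> ceil_div m i * m < i + m.
Proof.
move=> m0; rewrite /ceil_div; have := leq_divM (i + m.-1) m; lia.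
Qed.
End Ceiling.

Lemma le_floor_frac (z : int) (A B : nat) : (0 < B)%N ->
  (z <= Num.floor (A%:R / B%:R : rat)) = (z * B%:Z <= A%:Z).
Proof.
move=> B0; rewrite floor_ge_int ler_pdivlMr ?ltr0n //.
by rewrite -[B%:R]/(B%:Z%:~R) -[A%:R]/(A%:Z%:~R) -intrM ler_int.
Qed.

(** With [e = q + 1] and [M = e m], the ceiling in [beta] is the least exponent of [E] allowed in
    the component of index [i]. *)
Lemma ceil_frac (m e i : nat) : (0 < m)%N -> (0 < e)%N ->
  Num.ceil ((i * e)%:R / (e * m)%:R : rat) = (ceil_div m i)%:Z.
Proof.
move=> m0 e0; apply/ceil_def.
rewrite -[(i * e)%:R]/((i * e)%N%:Z%:~R) -[(e * m)%:R]/((e * m)%N%:Z%:~R).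
rewrite ltr_pdivlMr ?ltr0z ?ltz_nat ?muln_gt0 ?e0 // ler_pdivrMr ?ltr0z ?ltz_nat ?muln_gt0 ?e0 //.
rewrite -!intrM ltr_int ler_int.
have := ceil_div_ub i m0; have := ceil_div_lb i m0; set k := ceil_div m i.
by clearbody k; move: e0; clear; nia.
Qed.

Lemma is_function_field_scale (K F : fieldType) (iota : {rmorphism K -> F}) (x y : F)
    (u : K) (f g : {poly {poly K}}) : u != 0 -> f = u%:P%:P * g ->
  is_function_field iota x y f -> is_function_field iota x y g.
Proof.
move=> u0 fE [h1 h2]; split=> // k; rewrite h1; split=> -[w ->].
  by exists (u%:P%:P * w); rewrite fE mulrA [g * _]mulrC.
exists (u^-1%:P%:P * w); rewrite fE mulrACA [_ * u^-1%:P%:P]mulrC !mulrA.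
by rewrite -!polyCM mulVf // !polyC1 mul1r.
Qed.

(** Up to this constant and the sign in [curve_shift] the two equations coincide, so one argument
    covers both curves. *)
Definition curve_lead (K : fieldType) (C : curve) (c : K) : K :=
  match C with CurveX => c | CurveY => 1 end.

Definition curve_shift (K : fieldType) (C : curve) : K :=
  match C with CurveX => 1 | CurveY => -1 end.

Lemma curve_polyE (K : fieldType) C p a b M (c : K) :
  curve_poly C p a b M c = (curve_lead C c)%:P *: 'X^M -
    (base_poly K C p a b * (base_poly K C p a b ^+ (p ^ a - 1) + (curve_shift K C)%:P)
      ^+ (p ^ a + 1))%:P.
Proof.
by case: C; rewrite /curve_poly /curve_lead /curve_shift ?polyCN polyC1 ?scale1r.
Qed.

Lemma prod_XsubC_dvdp (K : fieldType) (t : {poly K}) N (gam : 'I_N -> K) :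
  injective gam -> (forall k, root t (gam k)) -> \prod_k ('X - (gam k)%:P) %| t.
Proof.
move=> ginj groot; have [|| T tE] := @uniq_roots_prod_XsubC K t (map gam (enum 'I_N)).
- by apply/allP => _ /mapP [k _ ->].
- by rewrite uniq_rootsE map_inj_uniq ?enum_uniq.
- by rewrite tE big_map big_enum dvdp_mull.
Qed.

Lemma separable_simple_root (K : fieldType) (t v : {poly K}) z :
  separable_poly t -> root t z -> ~~ root v z -> simple_root (t * v) z.
Proof.
move=> st /factor_theorem [t1 tE] nv; exists (t1 * v); first by rewrite tE mulrAC.
rewrite rootM negb_or nv andbT; move: st; rewrite tE separable_mul => /and3P [_ _].
by rewrite coprimep_XsubC.
Qed.

Theorem proposition4p1 (a b s n p q M d N : nat) (C : curve) (U : upsilon)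
    (K : finFieldType) (c : K) (F : fieldType) (iota : {rmorphism K -> F})
    (x y : F) (Q : 'I_N -> place iota)
    (ha : (1 <= a)%N) (hb : (1 <= b)%N) (hs : (1 <= s)%N) (hn : (3 <= n)%N)
    (hodd : odd n) (hba : (b %| a)%N) (hlt : (b < a)%N)
    (hp : prime p) (hq : q = (p ^ a)%N)
    (hsdvd : (s %| (q ^ n + 1) %/ (q + 1))%N)
    (hM : M = ((q ^ n + 1) %/ s)%N)
    (hd : d = curve_d C p b)
    (hK : #|K| = (q ^ (2 * n))%N)
    (hcq2 : c ^+ (q ^ 2) = c) (hc : c ^+ (q - 1) = -1)
    (hF : is_function_field iota x y (curve_poly C p a b M c))
    (hN : (2 <= N <= q %/ d)%N)
    (hinj : injective Q)
    (hQ : forall k, exists2 gamma : K,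
       root (base_poly K C p a b) gamma & lies_over_zero x gamma (Q k)) :
  upsilon_hat U Q =
    [set alpha | exists (i : nat) (j : 'I_N -> int),
       [/\ (1 <= i <= M - 1)%N,
           \sum_k j k = beta q d M i + 1 - N%:Z + rho U N &
           alpha = (fun k => M%:Z * j k + i%:Z)]]
    `|`
    [set alpha | exists j : 'I_N -> int,
       \sum_k j k = rho U N /\ alpha = (fun k => M%:Z * j k)]
  /\
  upsilon_pos U Q =
    [set alpha | exists (i : nat) (j : 'I_N -> nat),
       [/\ (1 <= i <= M - 1)%N,
           \sum_k (j k)%:Z = beta q d M i + 1 - N%:Z + rho U N &
           alpha = (fun k => M%:Z * (j k)%:Z + i%:Z)]].
Proof.
have p1 := prime_gt1 hp.
have q1 : (1 < q)%N by rewrite hq -[X in (X < _)%N](expn0 p) ltn_exp2l.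
have pK : p \in [pchar K]
  by apply: (card_finPcharP (n := (a * (2 * n))%N)); rewrite // hK hq -expnM.
have [m MeE] : exists m, M = (q.+1 * m)%N.
  have /dvdnP [k kE] := hsdvd; exists k; rewrite hM.
  have := divnK (dvdn_succ_exp_odd q hodd); rewrite -[q.+1]addn1 kE => <-.
  by rewrite mulnAC mulnK // mulnC.
have sM : (M * s = q ^ n + 1)%N.
  have /dvdnP [k kE] := hsdvd; rewrite hM divnK //.
  have := divnK (dvdn_succ_exp_odd q hodd); rewrite -[q.+1]addn1 kE => <-.
  by rewrite mulnAC dvdn_mull.
have M0 : (0 < M)%N by move: sM; case: (M) => //; rewrite addn1.
have m0 : (0 < m)%N by move: M0; rewrite MeE muln_gt0 => /andP [].
(* [M s = q ^ n + 1] equals [1] in characteristic [p]. *)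
have hMK : M%:R != 0 :> K.
  have : M%:R * s%:R = 1 :> K.
    rewrite -natrM sM natrD hq -expnM expp_eq0 ?add0r //.
    by rewrite muln_gt0 ha; apply: leq_trans hn.
  by move=> e; apply/eqP => M00; move/eqP: e; rewrite M00 mul0r eq_sym oner_eq0.
(* [|K| - 1 = (q ^ n - 1) (q ^ n + 1)] is a multiple of [M]. *)
have [zeta hzeta] : exists zeta : K, M.-primitive_root zeta.
  apply: finField_prim_root; rewrite hK mulnC expnM -subn1 -{2}(exp1n 2) subn_sqr -sM.
  by rewrite mulnCA dvdn_mulr.
set t := base_poly K C p a b.
have [hD d0] := curve_d_mul C pK hlt; rewrite -hd -hq in hD d0.
set D := (q %/ d)%N in hD hN.
have st : size t = D.+1 by rewrite /D hd hq; apply: size_base_poly.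
have sept : separable_poly t.
  by rewrite unlock (deriv_base_poly C pK hb hlt) coprimep1.
have t0 : t != 0 := separable_poly_neq0 sept.
pose eps := curve_shift K C.
have eps0 : eps != 0 by rewrite /eps; case: (C); rewrite ?oppr_eq0 oner_neq0.
pose u0 := curve_lead C c.
have c0 : c != 0.
  apply/eqP => c00; move/eqP: hc; rewrite c00 expr0n subn_eq0 leqNgt q1 /=.
  by rewrite eq_sym oppr_eq0 oner_eq0.
have u00 : u0 != 0 by rewrite /u0; case: (C); rewrite ?oner_neq0.
pose E := t ^+ (q - 1) + eps%:P.
pose h := u0^-1%:P * (t * E ^+ q.+1).
have fE : curve_poly C p a b M c = u0%:P%:P * ('X^M - h%:P).
  have hh : u0%:P * h = t * E ^+ q.+1.
    by rewrite /h mulrA -polyCM mulfV // polyC1 mul1r.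
  by rewrite mulrBr -polyCM hh mul_polyC curve_polyE -hq [(q + 1)%N]addn1.
have hF' : is_function_field iota x y ('X^M - h%:P) := is_function_field_scale u00 fE hF.
have q10 : (0 < q - 1)%N by rewrite subn_gt0.
(* [E] is congruent to the nonzero constant [eps] modulo [t]. *)
have cTE (v : {poly K}) : v %| t -> coprimep v E.
  move=> vt; apply: coprimep_dvdr vt _; rewrite /E -(prednK q10) exprSr.
  by rewrite coprimep_addl_mul -[eps%:P]mulr1 mul_polyC coprimepZr ?coprimep1.
(* Since [t' = 1] and [q = 0] in [K], the derivative of [E] is [- t ^ (q - 2)], which is prime to
   [E]. *)
have sepE : separable_poly E.
  rewrite unlock /E derivD derivC addr0 deriv_exp (deriv_base_poly C pK hb hlt) mul1r.
  rewrite -mulr_natl -polyC_natr natrB ?(ltnW q1) // hq (expp_eq0 pK ha) sub0r.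
  rewrite mul_polyC coprimepZr ?oppr_eq0 ?oner_neq0 // coprimep_expr // coprimep_sym.
  by rewrite -hq -/t -/E; apply: cTE.
have /choice [gam hgam0] : forall k, exists gamma : K, root t gamma /\ place_over x gamma (Q k).
  by move=> k; have [g rg lg] := hQ k; exists g; split=> //; apply: lies_over_zeroW.
have rgam k : root t (gam k) by case: (hgam0 k).
have ogam k : place_over x (gam k) (Q k) by case: (hgam0 k).
have E0 : E != 0 := separable_poly_neq0 sepE.
have h0 : h != 0 by rewrite !mulf_neq0 ?expf_neq0 // polyC_eq0 invr_eq0.
have hsimp k : simple_root h (gam k).
  rewrite /h mulrCA; apply: separable_simple_root => //.
  rewrite /root hornerM hornerC horner_exp mulf_neq0 ?invr_eq0 // expf_neq0 //.
  rewrite /E hornerD hornerC horner_exp (eqP (rgam k)) expr0n.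
  by rewrite subn_eq0 leqNgt q1 add0r.
have gaminj : injective gam := injective_gam M0 h0 hF' ogam hsimp hinj.
have /dvdpP [T tE] := prod_XsubC_dvdp gaminj rgam.
have hE : h = u0^-1%:P * (\prod_k ('X - (gam k)%:P)) * T * E ^+ q.+1.
  by rewrite /h tE; ring.
have Tt : T %| t by rewrite tE dvdp_mulr.
have sepT : separable_poly T by apply: dvdp_separable sept.
have T0 : T != 0 := separable_poly_neq0 sepT.
have sT : (size T).-1 = (D - N)%N.
  have : (size t).-1 = ((size T).-1 + N)%N.
    rewrite {1}tE size_predM // ?monic_neq0 ?monic_prod_XsubC //.
    by rewrite size_prod_XsubC -[index_enum _]enumT size_enum_ord.
  by rewrite st /= => ->; rewrite addnK.
have sE : (size E).-1 = (D * (q - 1))%N.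
  have stX : size (t ^+ (q - 1)) = (D * (q - 1)).+1.
    by rewrite (polySpred (expf_neq0 _ t0)) size_exp st.
  rewrite /E size_polyDl stX // size_polyC eps0 ltnS muln_gt0 q10 andbT.
  by case/andP: hN => N2 ND; apply: leq_trans ND; apply: leq_trans N2.
have sh : (size h).-1 = (D * q ^ 2)%N.
  rewrite /h mul_polyC size_scale ?invr_eq0 // size_predM ?expf_neq0 // size_predX // sE st /=.
  by move: q1; clear; nia.
(* Index 0 is separate because [T] enters only for [i > 0]: the general formula would give
   [D - N = deg T] instead of [0]. *)
pose B i := if i is 0 then 0 else beta q d M i + 1 - N%:Z.
have N2 : (2 <= N)%N by case/andP: hN.
have ND : (N <= D)%N by case/andP: hN.
have BE i (j : 'I_N -> int) : (i < M)%N ->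
    degree_condition M h T E i (ceil_div m i) j <-> B i <= \sum_(k < N) j k.
  move=> iM; rewrite /degree_condition sT sE sh; set S := \sum_k j k.
  case: i iM => [|i] iM.
    have -> : ceil_div m 0 = 0%N by rewrite /ceil_div add0n divn_small ?ltn_predL.
    by rewrite /= !muln0 mul0n sub0r mulrN oppr_le0 pmulr_rge0 // ltz_nat.
  rewrite /B /beta MeE addn1 (ceil_frac _ m0) // -MeE.
  set c' := ceil_div m i.+1; set fl := Num.floor _.
  have qqd : (q * (q - 1) %/ d = D * (q - 1))%N by rewrite -hD mulnAC mulnK // hD.
  rewrite qqd -/D.
  (* The degree condition is [M z <= i D q ^ 2]. Multiplied by [d], with [D d = q], it reads
     [z d M <= i q ^ 3], that is, [z] is at most the floor in [beta]. *)
  pose z : int := (D - N)%N%:Z + (D * (q - 1) * c')%N%:Z - S.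
  have zfl : (z <= fl) = (z * (d * M)%N%:Z <= (i.+1 * q ^ 3)%N%:Z).
    by apply: le_floor_frac; rewrite muln_gt0 d0.
  have zM : (z * (d * M)%N%:Z <= (i.+1 * q ^ 3)%N%:Z) =
      (M%:Z * z <= (i.+1 * (D * q ^ 2))%N%:Z).
    have -> : (i.+1 * q ^ 3 = d * (i.+1 * (D * q ^ 2)))%N.
      by rewrite (expnS q 2) -[X in (X * q ^ 2)%N]hD [(D * d)%N]mulnC -mulnA mulnCA.
    rewrite !(PoszM d) mulrCA ler_pM2l ?ltz_nat //.
    by rewrite [z * _]mulrC.
  rewrite muln1 PoszD -/z -zM -zfl /z PoszM.
  by move: ND; clearbody fl S c'; clear; split; lia.
have lift i j : (i < M)%N -> B i <= \sum_k j k -> weierstrass_semigroup Q (lift_tuple M i j).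
  exact: (kummer_semigroup_lift M0 h0 hF' ogam hsimp hinj hE MeE sepT sepE
    (fun i => ceil_div_ub i m0) BE).
have comp := kummer_semigroup_component M0 h0 hF' hMK hzeta ogam hsimp hinj hE MeE sepT sepE
  (cTE T Tt) (fun i => ceil_div_lb i m0) BE.
have hatE alpha : upsilon_hat U Q alpha <-> exists i j,
    [/\ (i < M)%N, \sum_k j k = B i + rho U N & alpha = lift_tuple M i j].
  case: (U) => /=; last exact: relative_maximalE.
  by under eq_exists => i do under eq_exists => j do rewrite addr0; apply: absolute_maximalE.
have rhoN : rho U N < N%:Z by case: (U) => /=; move: N2; clear; lia.
split; apply/seteqP; split.
- move=> alpha /hatE [[|i] [j [iM sj ->]]].
    right; exists j; rewrite sj add0r; split=> //.
    by apply/funext => k; rewrite /lift_tuple addr0.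
  by left; exists i.+1, j; split=> //; move: iM; clear; lia.
- move=> alpha [[i [j [/andP [i0 iM] sj ->]]]|[j [sj ->]]]; apply/hatE.
    exists i, j; split=> //; first by move: iM M0; clear; lia.
    by rewrite sj /B; case: (i) i0.
  exists 0%N, j; split=> //; first by rewrite add0r.
  by apply/funext => k; rewrite /lift_tuple addr0.
- move=> alpha [/hatE [i [j [iM sj ->]]] pos].
  (* From [M j_k + i > 0] and [i < M] one gets [M j_k > - M]. *)
  have j0 k : 0 <= j k.
    have := pos k; rewrite /lift_tuple /=; move: iM; clear; nia.
  have i0 : (0 < i)%N.
    (* With residue 0, positivity would force every [j_k >= 1], so the sum would be at least [N],
       which exceeds [rho]. *)
    rewrite lt0n; apply/eqP => i0; have : N%:Z <= \sum_k j k.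
      rewrite -[N in X in X <= _]card_ord -sum1_card -natz natr_sum; apply: ler_sum => k _.
      have := pos k; rewrite /lift_tuple i0 /=; move: M0; clear; nia.
    by rewrite sj i0 add0r leNgt rhoN.
  exists i, (fun k => `|j k|%N); split; first by rewrite i0 /=; move: iM; clear; lia.
    under eq_bigr => k _ do rewrite gez0_abs //.
    by rewrite sj /B; case: (i) i0.
  by apply/funext => k; rewrite /lift_tuple gez0_abs.
move=> alpha [i [j [/andP [i0 iM] sj ->]]]; split.
  apply/hatE; exists i, (fun k => (j k)%:Z); split=> //; first by move: iM M0; clear; lia.
  by rewrite sj /B; case: (i) i0.
by move=> k; move: i0; clear; nia.
Qed.
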